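(* Let $s\ge2$. For any singular graphon $\gamma$, any finite graphs $F_1,\ldots,F_s$ with sizes (numbers of vertices) $k_1,\ldots,k_s\ge2$, and any $n\ge1$, $$|\kappa(S_n(F_1),\ldots,S_n(F_s))|\le 2^{s-1}\,(k_1+\cdots+k_s)^s\,k_1k_2\cdots k_s\,n^{k_1+\cdots+k_s-s}.$$
   Context: Graphs are finite, simple and undirected. A graph function is a measurable symmetric $g:[0,1]^2\to[0,1]$ (up to null sets); a graphon $\gamma=[g]$ is an equivalence class of graph functions for the relation $\delta_\square=0$, where $\delta_\square$ is the cut-metric $\inf_\sigma \sup_{S,T}|\int_{S\times T}(g_1(\sigma(x),\sigma(y))-g_2(x,y))\,dx\,dy|$, $\sigma$ running over measure-preserving measurable bijections of $[0,1]$ and $S,T$ over measurable subsets. For a graph $F$ on $\{1,\dots,k\}$, $t(F,\gamma)=\int_{[0,1]^k}\prod_{\{i,j\}\in E_F}g(x_i,x_j)\,dx_1\cdots dx_k$. For graphs $F_1,F_2$ on $k_1,k_2\ge1$ vertices, $F_1F_2$ is their disjoint union and $(F_1\bowtie F_2)(i_1,i_2)$ is the graph obtained from it by identifying vertex $i_1$ of $F_1$ with vertex $i_2$ of $F_2$. The graphon $\gamma$ is singular if for all finite graphs $F_1,F_2$, $t(F_1F_2,\gamma)=\frac1{k_1k_2}\sum_{i_1=1}^{k_1}\sum_{i_2=1}^{k_2}t((F_1\bowtie F_2)(i_1,i_2),\gamma)$. The $W$-random graph $G_n(\gamma)$ has vertex set $\{1,\dots,n\}$; with $(X_i)$ and $(U_{ij})_{i<j}$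 independent uniform on $[0,1]$, $i<j$ are connected iff $U_{ij}\le g(X_i,X_j)$. $S_n(F)=|\hom(F,G_n(\gamma))|$ is the number of maps $V_F\to\{1,\dots,n\}$ sending edges of $F$ to edges of $G_n(\gamma)$; all $S_n(F_i)$ are computed on the same random graph. The joint cumulant of bounded random variables is $\kappa(X_1,\dots,X_s)=\sum_\pi(-1)^{\ell(\pi)-1}(\ell(\pi)-1)!\prod_{i=1}^{\ell(\pi)}\mathbb{E}[\prod_{j\in\pi_i}X_j]$, the sum being over set partitions $\pi=\pi_1\sqcup\cdots\sqcup\pi_{\ell(\pi)}$ of $\{1,\dots,s\}$. *)

(* Defs.v *)
(* MathComp / MathComp-Analysis *)
From HB Require Import structures.
From mathcomp Require Import all_boot all_order all_algebra.
From mathcomp Require Import all_classical all_reals all_analysis.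

Set Implicit Arguments.
Unset Strict Implicit.
Unset Printing Implicit Defensive.

Import Order.TTheory GRing.Theory Num.Theory.

Local Open Scope classical_set_scope.
Local Open Scope ring_scope.

Record sgraph (V : finType) := SGraph {
  adj :> rel V;
  adj_sym : symmetric adj;
  adj_irr : irreflexive adj }.

Section graph_operations.
Context (V1 V2 : finType) (F1 : sgraph V1) (F2 : sgraph V2).

Definition disjoint_union_rel : rel (V1 + V2) := fun x y =>
  match x, y with
  | inl a, inl b => F1 a b
  | inr a, inr b => F2 a b
  | _, _ => false
  end.

Lemma disjoint_union_sym : symmetric disjoint_union_rel.
Proof. by move=> [a|a] [b|b] //=; rewrite adj_sym. Qed.

Lemma disjoint_union_irr : irreflexive disjoint_union_rel.
Proof. by move=> [a|a] /=; rewrite adj_irr. Qed.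

Definition disjoint_union := SGraph disjoint_union_sym disjoint_union_irr.

(* Identification of i1 and i2: the merged vertex is represented by inl i1, so
   i2 is removed from V2 and its edges are attached to inl i1. *)
Definition merge_rel (i1 : V1) (i2 : V2) : rel (V1 + {v : V2 | v != i2}) :=
  fun x y =>
  match x, y with
  | inl a, inl b => F1 a b
  | inr a, inr b => F2 (val a) (val b)
  | inl a, inr b => (a == i1) && F2 i2 (val b)
  | inr a, inl b => (b == i1) && F2 (val a) i2
  end.

Lemma merge_sym i1 i2 : symmetric (@merge_rel i1 i2).
Proof. by move=> [a|a] [b|b] //=; rewrite adj_sym. Qed.

Lemma merge_irr i1 i2 : irreflexive (@merge_rel i1 i2).
Proof. by move=> [a|a] /=; rewrite adj_irr. Qed.

Definition merge i1 i2 := SGraph (@merge_sym i1 i2) (@merge_irr i1 i2).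

End graph_operations.

Definition hom_count (V W : finType) (F : sgraph V) (G : sgraph W) : nat :=
  #|[pred f : {ffun V -> W} | [forall u, forall v, F u v ==> G (f u) (f v)]]|.

Section graphons.
Context (R : realType).

Definition unit_itv : set R := `[0, 1].

(* A function on [0,1]^2 is represented by a total function on R^2 whose values
   outside [0,1]^2 are arbitrary and never used. *)
Definition graph_function (g : R * R -> R) :=
  [/\ measurable_fun (unit_itv `*` unit_itv) g,
      forall x y, unit_itv x -> unit_itv y -> g (x, y) = g (y, x) &
      forall x y, unit_itv x -> unit_itv y -> 0 <= g (x, y) <= 1].

Definition measure_preserving_bijection (sigma : R -> R) :=
  [/\ set_bij unit_itv unit_itv sigma,
      measurable_fun unit_itv sigma &
      forall A, measurable A -> A `<=` unit_itv ->
        lebesgue_measure (unit_itv `&` sigma @^-1` A) = lebesgue_measure A].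

Definition cut_norm (h : R * R -> R) : \bar R :=
  ereal_sup [set z | exists S T : set R,
    [/\ measurable S, measurable T, S `<=` unit_itv, T `<=` unit_itv &
        z = `| \int[(lebesgue_measure \x lebesgue_measure)%E]_(p in S `*` T)
                 h p |%:E]].

Definition cut_metric (g1 g2 : R * R -> R) : \bar R :=
  ereal_inf [set cut_norm (fun p => g1 (sigma p.1, sigma p.2) - g2 p)
            | sigma in measure_preserving_bijection].

Record graphon := Graphon {
  graphon_class : set (R * R -> R);
  graphonP : exists2 g, graph_function g &
    graphon_class = [set h | graph_function h /\ cut_metric g h = 0%E] }.

Definition unit_law : probability (measurableTypeR R) R :=
  uniform_prob (@ltr01 R).

Definition cons_tuple (k : nat) (p : measurableTypeR R * k.-tuple R) :
    k.+1.-tuple R :=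
  [the k.+1.-tuple R of p.1 :: p.2].

Lemma measurable_cons_tuple k : measurable_fun setT (@cons_tuple k).
Proof.
apply: measurable_cons; last exact: measurable_snd.
exact: (@measurable_fst _ _ (measurableTypeR R) (k.-tuple R)).
Qed.

HB.instance Definition _ k :=
  isMeasurableFun.Build _ _ _ _ (@cons_tuple k) (@measurable_cons_tuple k).

(* Lebesgue measure on [0,1]^k, as a measure on R^k. *)
Fixpoint cube_law (k : nat) : probability (k.-tuple R) R :=
  match k with
  | 0 => \d_([tuple] : 0.-tuple R)
  | k'.+1 => distribution (unit_law \x cube_law k')%E (@cons_tuple k')
  end.

(* The vertices of F are labelled by enum_rank; each edge is counted once, as
   the pair of its endpoints in increasing order of labels. *)
Definition hom_density (V : finType) (F : sgraph V) (g : R * R -> R) : R :=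
  \int[cube_law #|V|]_(x in [set x | forall i, unit_itv (tnth x i)])
    \prod_(e : V * V | F e.1 e.2 && (enum_rank e.1 < enum_rank e.2)%N)
      g (tnth x (enum_rank e.1), tnth x (enum_rank e.2)).

Definition singular (gamma : graphon) :=
  forall g, graphon_class gamma g ->
  forall (k1 k2 : nat) (F1 : sgraph 'I_k1) (F2 : sgraph 'I_k2),
    (1 <= k1)%N -> (1 <= k2)%N ->
    hom_density (disjoint_union F1 F2) g =
    (k1%:R * k2%:R)^-1 *
      \sum_(i1 < k1) \sum_(i2 < k2) hom_density (merge F1 F2 i1 i2) g.

End graphons.

Definition increasing_pair (n : nat) := {p : 'I_n * 'I_n | (p.1 < p.2)%N}.

Section W_random_graph.
Context (R : realType) (n : nat) (g : R * R -> R).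
Context (x : 'I_n -> R) (u : increasing_pair n -> R).

Definition W_rel : rel 'I_n := fun i j =>
  [exists p : increasing_pair n,
    ((val p == (i, j)) || (val p == (j, i))) &&
    (u p <= g (x (val p).1, x (val p).2))].

Lemma W_sym : symmetric W_rel.
Proof. by move=> i j; apply: eq_existsb => p; rewrite orbC. Qed.

Lemma W_irr : irreflexive W_rel.
Proof.
move=> i; apply/existsP => -[[[a b] /= ab]] /andP[/orP[] /eqP[ai bi] _];
by rewrite ai bi ltnn in ab.
Qed.

Definition W_graph := SGraph W_sym W_irr.

End W_random_graph.

Section probability.
Context (R : realType) (d : measure_display) (Omega : measurableType d).
Context (P : probability Omega R).

Definition mutually_independent (I : finType) (Y : I -> Omega -> R) :=
  forall (J : {set I}) (A : I -> set R), (forall i, measurable (A i)) ->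
    P (\bigcap_(i in [set` J]) Y i @^-1` A i) =
    (\prod_(i in J) P (Y i @^-1` A i))%E.

Definition uniform01 (Y : {RV P >-> R}) :=
  forall A, measurable A -> distribution P Y A = unit_law R A.

(* The variables driving G_n. The X_i are required to be [0,1]-valued at every
   sample point, as they are arguments of a function on [0,1]^2. *)
Record W_sample (n : nat) (X : 'I_n -> {RV P >-> R})
    (U : increasing_pair n -> {RV P >-> R}) : Prop := WSample {
  X_range : forall i w, unit_itv (X i w);
  X_uniform : forall i, uniform01 (X i);
  U_uniform : forall p, uniform01 (U p);
  XU_independent : mutually_independent
    (fun a : 'I_n + increasing_pair n =>
       match a with inl i => X i : Omega -> R | inr p => U p end) }.

Definition S_hom (n : nat) (g : R * R -> R) (X : 'I_n -> {RV P >-> R})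
    (U : increasing_pair n -> {RV P >-> R}) (V : finType) (F : sgraph V) :
    Omega -> R :=
  fun w => (hom_count F (W_graph g (X ^~ w) (U ^~ w)))%:R.

(* Intended for bounded random variables, whose moments are finite. *)
Definition joint_cumulant (s : nat) (Y : 'I_s -> Omega -> R) : R :=
  \sum_(pi : {set {set 'I_s}} | finset.partition pi [set: 'I_s]%SET)
    (-1) ^+ (#|pi| - 1) * ((#|pi| - 1)`!)%:R *
    \prod_(B in pi) fine 'E_P[fun w => \prod_(j in B) Y j w].

End probability.

(* Main.v *)
Require Import Defs.
From mathcomp Require Import all_boot all_order all_algebra.
From mathcomp Require Import all_classical all_reals all_analysis.
From mathcomp Require Import perm measurable_realfun ring lra zify.

(** Write each homomorphism count as a sum, over all maps phi from the disjoint
union of the vertex sets to {1, ..., n}, of indicators A_j(phi), where A_j(phi)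
is the event that the j-th block of phi is a homomorphism.  By multilinearity
the joint cumulant is the sum over phi of the joint cumulant kappa(phi) of the
indicators A_j(phi) ([joint_cumulant_kappa]).  With K vertices and s graphs,
the maps phi are sorted by the size of their image.

Bounding one cumulant.  Under the convolution (f * g)(B) = sum of f(S) g(B \ S)
over the subsets S of B, the moment function M has an inverse, and kappa is the
value of M(i u .) * M^-1 on the complement of any root i ([cumulant_root]).
More generally the cumulant of a product over A together with the variables
indexed by B is M(A u .) * M^-1, and it satisfies
   kappa(A; b u B) = kappa(b u A; B) - sum of kappa(A; S) kappa(b; B \ S)
([merged_cumulant_setU1]).  Counting, with multiplicity, the trees on the
blocks whose edges join blocks with a common value gives a number that obeys
the matching inequality, whence |kappa| <= 2^(s-1) times that number
([merged_cumulant_le_forest]).  In particular kappa(phi) is zero unless the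
images of the blocks hang together, and then the image of phi has at most
K - s + 1 points ([card_values_tree]).

The maps of maximal image cancel.  If the image has exactly K - s + 1 points,
some block i is a leaf: it is placed injectively and meets the other blocks in
a single point ([tree_leaf]).  Taking i as root, M^-1 does not involve block i,
so summing the cumulants over the choice of the vertex of F_i placed at the
meeting point amounts to summing the moments M(i u .).  Singularity, applied to
F_1 = F_2 = F, says that the sum over the vertices a of F of the conditional
density of F given the position of a has variance zero; so it is constant
almost everywhere ([singular_attach]), the sum of moments factorizes
([moment_leaf]), and the sum of cumulants vanishes ([leaf_sum0],
[tree_like_sum0]).

The other maps are few.  For these, K - s + 1 minus the size of the image is at
least 1, so it may be inserted as a weight.  The weighted sum is computed
exactly: the total tree count of the maps into a set W with m points is
k_1 ... k_s K^(s-2) m^(K-s+1) by a weighted Cayley formula ([forest_Cayley],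
[sum_forest_tree]), and the size of the image is n minus the number of points
missed by phi, while the maps missing a point are the maps into its
complement.  The result is at most k_1 ... k_s K^s n^(K-s)
([sum_tree_excess]). *)

Set Implicit Arguments.
Unset Strict Implicit.
Unset Printing Implicit Defensive.

Import Order.TTheory GRing.Theory Num.Theory.

Local Open Scope ring_scope.

(** * Subset convolution and cumulants *)

Section SubsetConvolution.
Import mathcomp.boot.fintype mathcomp.boot.finset.
Variables (I : finType) (R : comPzRingType).
Implicit Types (f g h M : {set I} -> R) (A B C S T : {set I}).

(** The product of exponential generating functions in commuting variables
    indexed by I that square to zero; it is what lets moments and cumulants be
    handled as series. *)
Definition subset_conv f g B : R := \sum_(S : {set I} | S \subset B) f S * g (B :\: S).

Definition subset_conv1 B : R := (B == set0)%:R.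

Lemma eq_subset_conv f f' g g' B :
  (forall S, S \subset B -> f S = f' S) -> (forall S, S \subset B -> g S = g' S) ->
  subset_conv f g B = subset_conv f' g' B.
Proof.
move=> ff gg; apply: eq_bigr => S SB; rewrite ff // gg //.
exact: subsetDl.
Qed.

Lemma big_subset_compl (F : {set I} -> {set I} -> R) B :
  \sum_(S : {set I} | S \subset B) F S (B :\: S) =
  \sum_(S : {set I} | S \subset B) F (B :\: S) S.
Proof.
rewrite (reindex_onto (fun S => B :\: S) (fun S => B :\: S)) /=; last first.
  by move=> S SB; rewrite setDDr setDv set0U (setIidPr SB).
apply: eq_big => [S|S].
  rewrite subsetDl /=; apply/eqP/idP => [<-|SB]; first exact: subsetDl.
  by rewrite setDDr setDv set0U (setIidPr SB).
by case/andP => _ /eqP ->.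
Qed.

Lemma subset_convC f g B : subset_conv f g B = subset_conv g f B.
Proof.
rewrite /subset_conv (big_subset_compl (fun S T => f S * g T)).
by apply: eq_bigr => S _; rewrite mulrC.
Qed.

(** Both sides enumerate the ordered partitions of B into three parts. *)
Lemma big_subset_triple (F : {set I} -> {set I} -> {set I} -> R) B :
  \sum_(S : {set I} | S \subset B) \sum_(T : {set I} | T \subset S) F T (S :\: T) (B :\: S) =
  \sum_(S : {set I} | S \subset B) \sum_(T : {set I} | T \subset B :\: S)
     F S T (B :\: S :\: T).
Proof.
rewrite (exchange_big_dep (fun T : {set I} => T \subset B)) /=; last first.
  by move=> S T SB TS; apply: subset_trans TS SB.
apply: eq_bigr => T TB.
rewrite (reindex_onto (fun S => T :|: S) (fun S => S :\: T)) /=; last first.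
  by move=> S /andP[SB TS]; rewrite -[RHS](setID S T) (setIidPr TS).
apply: eq_big => [S|S].
  rewrite subUset TB subsetUl andbT setDUl setDv set0U subsetD /=.
  by congr (_ && _); apply/eqP/idP => [/setDidPl//|?]; apply/setDidPl.
case/andP => _ /eqP ->; congr F.
by rewrite setDDl.
Qed.

Lemma subset_convA f g h B : subset_conv (subset_conv f g) h B =
  subset_conv f (subset_conv g h) B.
Proof.
rewrite /subset_conv.
under eq_bigr do rewrite big_distrl.
rewrite (big_subset_triple (fun S T U => f S * g T * h U)).
apply: eq_bigr => S _; rewrite big_distrr; apply: eq_bigr => T _ /=.
by rewrite mulrA.
Qed.

Lemma subset_conv1l f B : subset_conv subset_conv1 f B = f B.
Proof.
rewrite /subset_conv (bigD1 set0) ?sub0set //=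
  /subset_conv1 eqxx mul1r setD0 big1 ?addr0 // => S.
by case/andP => _ /negbTE ->; rewrite mul0r.
Qed.

Lemma subset_conv_set0 f g : subset_conv f g set0 = f set0 * g set0.
Proof. by rewrite /subset_conv (big_pred1 set0) ?setD0 // => S; rewrite subset0. Qed.

Lemma big_subset_setU1 (F : {set I} -> R) b B : b \notin B ->
  \sum_(S : {set I} | S \subset b |: B) F S =
  \sum_(S : {set I} | S \subset B) (F S + F (b |: S)).
Proof.
move=> bB; rewrite big_split /= (bigID (fun S : {set I} => b \in S)) /= addrC.
congr (_ + _).
  by apply: eq_bigl => S; rewrite -subsetD1 setU1K.
rewrite (reindex_onto (fun S => b |: S) (fun S => S :\ b)) /=; last first.
  by move=> S /andP[_ bS]; rewrite setD1K.
apply: eq_bigl => S; rewrite setU11 andbT.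
have [bS|bS] := boolP (b \in S).
  rewrite [RHS](_ : _ = false); last by apply: contraNF bB => /subsetP/(_ _ bS).
  apply/negbTE; rewrite negb_and orbC; apply/orP; left.
  by apply: contraTneq bS => <-; rewrite !inE eqxx.
rewrite setU1K // eqxx andbT; apply/idP/idP => [/subsetP H|/setUS//].
apply/subsetP => x xS; have := H x; rewrite !inE xS orbT => /(_ isT).
by case/predU1P => // xb; rewrite -xb xS in bS.
Qed.

(** The product rule, for the derivative f |-> f (b |: _). *)
Lemma subset_conv_setU1 f g b B : b \notin B ->
  subset_conv f g (b |: B) =
  subset_conv (fun S => f (b |: S)) g B + subset_conv f (fun S => g (b |: S)) B.
Proof.
move=> bB; rewrite /subset_conv big_subset_setU1 // big_split /= addrC.
congr (_ + _); apply: eq_bigr => S SB.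
  congr (_ * g _); apply/setP => x; rewrite !inE.
  have [->|_] /= := eqVneq x b; last by [].
  by rewrite (negbTE bB) andbF.
rewrite setDUl; congr (_ * g (_ :|: _)); apply/setDidPl.
by rewrite disjoints1; apply: contra bB; apply: subsetP.
Qed.

Lemma subset_conv_opp f g B : subset_conv f (fun S => - g S) B = - subset_conv f g B.
Proof. by rewrite /subset_conv -sumrN; apply: eq_bigr => S _; rewrite mulrN. Qed.

Lemma subset_conv_scale c f g B : subset_conv (fun S => c * f S) g B = c * subset_conv f g B.
Proof. by rewrite /subset_conv big_distrr; apply: eq_bigr => S _ /=; rewrite mulrA. Qed.

(** A partition with a distinguished block amounts to that block and a
    partition of what it leaves; both the inversion formula and the choice of a
    root for cumulants come from this. *)
Lemma big_partition_block (F : {set I} -> {set {set I}} -> R) B :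
  \sum_(S : {set I} | (S \subset B) && (S != set0))
    \sum_(pi : {set {set I}} | partition pi (B :\: S)) F S pi =
  \sum_(pi : {set {set I}} | partition pi B) \sum_(S in pi) F S (pi :\ S).
Proof.
rewrite [RHS](exchange_big_dep (fun S => (S \subset B) && (S != set0))) /=; last first.
  by move=> pi S piB Spi; rewrite (partitionS piB Spi) (partition_neq0 piB Spi).
apply: eq_bigr => S /andP[SB S0].
rewrite [RHS](reindex_onto (fun pi : {set {set I}} => S |: pi) (fun pi => pi :\ S)) /=;
  last first.
  by move=> pi /andP[_ Spi]; rewrite setD1K.
have key (pi : {set {set I}}) : partition pi (B :\: S) -> S \notin pi.
  move=> piB; apply: contra S0 => Spi; have := partitionS piB Spi.
  by rewrite subsetD -setI_eq0 setIid => /andP[].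
apply: eq_big => [pi|pi piB].
  rewrite setU11 andbT; apply/idP/andP => [piB|[piB /eqP <-]].
    split; last by rewrite setU1K // key.
    have SBS : S :|: (B :\: S) = B by rewrite -{2}(setID B S) (setIidPr SB).
    rewrite -[in X in partition _ X]SBS; apply: (partitionU1 piB S0).
    by rewrite disjoint_sym disjoints_subset setDE subsetIr.
  exact: partitionD1 piB (setU11 _ _).
by rewrite setU1K // key.
Qed.

(** The geometric series for M^-1: each partition into m blocks arises from m!
    ordered ones. *)
Definition subset_conv_inv M B : R :=
  \sum_(pi : {set {set I}} | partition pi B)
    (-1) ^+ #|pi| * ((#|pi|)`!)%:R * \prod_(S in pi) M S.

Lemma subset_conv_inv0 M : subset_conv_inv M set0 = 1.
Proof.
rewrite /subset_conv_inv (big_pred1 set0); last by move=> pi; rewrite partition_set0.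
by rewrite cards0 big_set0 !mulr1.
Qed.

Lemma subset_convV M B : M set0 = 1 -> subset_conv M (subset_conv_inv M) B = subset_conv1 B.
Proof.
move=> M0; rewrite /subset_conv1; have [->|B0] := eqVneq B set0.
  by rewrite subset_conv_set0 M0 subset_conv_inv0 mulr1.
rewrite /subset_conv (bigD1 set0) ?sub0set //= M0 mul1r setD0.
under eq_bigr do rewrite /subset_conv_inv big_distrr.
rewrite (big_partition_block (fun S (pi : {set {set I}}) => M S *
  ((-1) ^+ #|pi| * ((#|pi|)`!)%:R * \prod_(S in pi) M S))).
rewrite -big_split /= big1 // => pi piB.
have /card_gt0P[S0 S0pi] : (0 < #|pi|)%N.
  rewrite card_gt0; apply: contra B0 => /eqP pi0.
  by rewrite -(cover_partition piB) pi0 /cover big_set0.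
rewrite [X in _ + X](eq_bigr (fun _ => (-1) ^+ (#|pi| - 1) * ((#|pi| - 1)`!)%:R *
  \prod_(S in pi) M S)); last first.
  move=> S Spi; have -> : (#|pi| - 1)%N = #|pi :\ S| by rewrite (cardsD1 S pi) Spi addKn.
  by rewrite [in RHS](big_setD1 S) //= mulrCA.
rewrite sumr_const.
case: #|pi| (cardsD1 S0 pi) => [|m]; first by rewrite S0pi.
move=> _; rewrite subn1 /= factS exprS natrM -[X in _ + X]mulr_natr.
by move: ((-1) ^+ m) (m`!%:R) (m.+1%:R) => x y z; ring.
Qed.

(** As a function of B this is M(A u .) / M; for A a singleton it is the
    derivative of log M, which is why it yields joint cumulants. *)
Definition merged_cumulant M A B := subset_conv (fun S => M (A :|: S)) (subset_conv_inv M) B.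

Lemma merged_cumulant_set0 M A : merged_cumulant M A set0 = M A.
Proof. by rewrite /merged_cumulant subset_conv_set0 subset_conv_inv0 mulr1 setU0. Qed.

(** Independence makes M(A u .) proportional to M, so the quotient by M is a
    constant. *)
Lemma merged_cumulant_indep M A B : M set0 = 1 -> B != set0 ->
  (forall S, S \subset B -> M (A :|: S) = M A * M S) -> merged_cumulant M A B = 0.
Proof.
move=> M0 B0 MA; rewrite /merged_cumulant
  (eq_subset_conv (f' := fun S => M A * M S) (g' := subset_conv_inv M)) //.
by rewrite subset_conv_scale subset_convV // /subset_conv1 (negbTE B0) mulr0.
Qed.

(** The derivative of 1 / M is - M' / M^2. *)
Lemma subset_conv_inv_setU1 M b B : M set0 = 1 -> b \notin B ->
  subset_conv_inv M (b |: B) =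
  - subset_conv (subset_conv_inv M) (subset_conv (fun S => M (b |: S)) (subset_conv_inv M)) B.
Proof.
move=> M0 bB.
have dz C : b \notin C -> subset_conv M (fun S => subset_conv_inv M (b |: S)) C =
    - subset_conv (fun S => M (b |: S)) (subset_conv_inv M) C.
  move=> bC; have := subset_convV (b |: C) M0; rewrite subset_conv_setU1 // /subset_conv1.
  rewrite (_ : (b |: C == set0) = false); first by move/eqP; rewrite addrC addr_eq0 => /eqP.
  by apply/negbTE/set0Pn; exists b; rewrite setU11.
rewrite -subset_conv_opp.
rewrite -(eq_subset_conv (f := subset_conv_inv M)
  (g := subset_conv M (fun S => subset_conv_inv M (b |: S)))) //.
  rewrite -subset_convA (eq_subset_conv (f' := subset_conv1)
    (g' := fun S => subset_conv_inv M (b |: S))) //.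
    by rewrite subset_conv1l.
  by move=> S _; rewrite subset_convC subset_convV.
by move=> S SB; apply: dz; apply: contra bB; apply: subsetP.
Qed.

(** The quotient rule for the derivative of M(A u .) / M. *)
Lemma merged_cumulant_setU1 M A b B : M set0 = 1 -> b \notin B ->
  merged_cumulant M A (b |: B) =
  merged_cumulant M (b |: A) B - subset_conv (merged_cumulant M A) (merged_cumulant M [set b])
    B.
Proof.
move=> M0 bB; rewrite /merged_cumulant subset_conv_setU1 //; congr (_ + _).
  by apply: eq_subset_conv => // S _; rewrite setUA (setUC A).
rewrite (eq_subset_conv (f' := fun S => M (A :|: S))
  (g' := fun S => - subset_conv (subset_conv_inv M)
  (subset_conv (fun S => M (b |: S)) (subset_conv_inv M)) S)) //; last first.
  by move=> S SB; rewrite subset_conv_inv_setU1 //; apply: contra bB; apply: subsetP.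
by rewrite subset_conv_opp -subset_convA.
Qed.

(** The block containing the root i plays the part of the derivative of M, the
    other blocks that of 1 / M; the factor (m - 1)! is the one that the series
    gives to m - 1 blocks. *)
Lemma cumulant_root M i B : i \in B ->
  \sum_(pi : {set {set I}} | partition pi B)
    (-1) ^+ (#|pi| - 1) * ((#|pi| - 1)`!)%:R * \prod_(S in pi) M S =
  merged_cumulant M [set i] (B :\ i).
Proof.
move=> iB.
rewrite /merged_cumulant /subset_conv.
transitivity (\sum_(S : {set I} | (S \subset B) && (S != set0))
    \sum_(pi : {set {set I}} | partition pi (B :\: S))
     (i \in S)%:R * M S * ((-1) ^+ #|pi| * ((#|pi|)`!)%:R * \prod_(S in pi) M S)).
  rewrite (big_partition_block (fun S (pi : {set {set I}}) => (i \in S)%:R * M S *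
    ((-1) ^+ #|pi| * ((#|pi|)`!)%:R * \prod_(S in pi) M S))).
  apply: eq_bigr => pi piB.
  have icov : i \in cover pi by rewrite (cover_partition piB).
  have tI := partition_trivIset piB.
  have Spi := pblock_mem icov.
  rewrite [RHS](bigD1 (pblock pi i)) //= mem_pblock icov mul1r.
  rewrite [X in _ = _ + X]big1 ?addr0; last first.
    move=> S /andP[Spi' SN]; rewrite (_ : (i \in S) = false) ?mul0r //.
    by apply/negbTE; apply: contra SN => iS; rewrite (def_pblock tI Spi' iS).
  have -> : (#|pi| - 1)%N = #|pi :\ pblock pi i|.
    by rewrite (cardsD1 (pblock pi i) pi) Spi addKn.
  by rewrite [in LHS](big_setD1 (pblock pi i)) //= mulrCA.
rewrite (bigID (fun S : {set I} => i \in S)) /= [X in _ + X]big1 ?addr0; last first.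
  by move=> S /andP[_ /negbTE iS]; apply: big1 => pi _; rewrite iS !mul0r.
rewrite (reindex_onto (fun S => i |: S) (fun S => S :\ i)) /=; last first.
  by move=> S /andP[_ iS]; rewrite setD1K.
apply: eq_big => [S|S SB].
  rewrite setU11 andbT; have -> : i |: S != set0 by apply/set0Pn; exists i; rewrite setU11.
  rewrite andbT subsetD1 subUset sub1set iB /=; congr (_ && _).
  apply/eqP/idP => [<-|iS]; first by rewrite !inE eqxx.
  by rewrite setU1K.
rewrite setU11 mul1r /subset_conv_inv big_distrr /= setDDl.
by apply: eq_bigr.
Qed.

End SubsetConvolution.

(** * Weighted trees and the cumulant bound *)

Section ForestWeight.
Import mathcomp.boot.fintype mathcomp.boot.finset.
Variables (I : finType) (R : comPzRingType) (w : I -> I -> R).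
Implicit Types (L : seq I) (A B C S T : {set I}).

(** Depth-first exploration: the roots of L are treated in turn, each choosing
    its set S of children among the unreached vertices B. The first argument is
    fuel. *)
Fixpoint forest_rec m L B : R :=
  match L, m with
  | [::], _ => subset_conv1 R B
  | a :: L', 0 => 0
  | a :: L', m'.+1 =>
      \sum_(S : {set I} | S \subset B)
        (\prod_(b in S) w a b) * forest_rec m' (enum S ++ L') (B :\: S)
  end.

(** For L without repetition and disjoint from B: the sum, over the spanning
    forests of L and B in which each tree contains exactly one element of L, of
    the product of the weights w parent child. The fuel is exact, since each
    step removes one root and moves S from B to the roots. *)
Definition forest_weight L B := forest_rec (size L + #|B|) L B.

Lemma forest_nil B : forest_weight [::] B = subset_conv1 R B.
Proof. by rewrite /forest_weight; case: (_ + _)%N. Qed.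

Lemma forest_cons a L B : forest_weight (a :: L) B =
  \sum_(S : {set I} | S \subset B)
     (\prod_(b in S) w a b) * forest_weight (enum S ++ L) (B :\: S).
Proof.
rewrite /forest_weight /=; apply: eq_bigr => S SB; congr (_ * forest_rec _ _ _).
by rewrite size_cat -cardE cardsD (setIidPr SB); have := subset_leq_card SB; lia.
Qed.

Lemma forest_set0 L : forest_weight L set0 = 1.
Proof.
elim: L => [|a L IH]; first by rewrite forest_nil /subset_conv1 eqxx.
rewrite forest_cons (big_pred1 set0); last by move=> S; rewrite subset0.
by rewrite big_set0 mul1r enum_set0 setD0.
Qed.

(** A forest rooted at L1 ++ L2 splits into the trees rooted at L1 and those
    rooted at L2. *)
Lemma forest_cat L1 L2 B : forest_weight (L1 ++ L2) B =
  subset_conv (forest_weight L1) (forest_weight L2) B.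
Proof.
have [m] := ubnP (size L1 + #|B|); elim: m L1 B => // m IH [|a L1] B /=.
  by move=> _; rewrite -[LHS]subset_conv1l; apply: eq_subset_conv => // S _; rewrite forest_nil.
rewrite addSn ltnS => lt_m; rewrite forest_cons.
rewrite /subset_conv.
under [RHS]eq_bigr do rewrite forest_cons big_distrl /=.
rewrite (big_subset_triple (fun S T U => \prod_(b in S) w a b *
  forest_weight (enum S ++ L1) T * forest_weight L2 U)).
apply: eq_bigr => S SB; rewrite catA IH; last first.
  rewrite size_cat -cardE cardsD (setIidPr SB).
  by have := subset_leq_card SB; move: lt_m; lia.
by rewrite big_distrr; apply: eq_bigr => T _ /=; rewrite mulrA.
Qed.

Lemma perm_forest L1 L2 B : perm_eq L1 L2 -> forest_weight L1 B = forest_weight L2 B.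
Proof.
elim: L1 L2 B => [|a L1 IH] L2 B; first by rewrite perm_sym => /perm_nilP ->.
move=> p12; have aL2 : a \in L2 by rewrite -(perm_mem p12) mem_head.
move: p12; case/splitPr: aL2 => p1 p2 p12.
have p12' : perm_eq L1 (p1 ++ p2).
  rewrite -(perm_cons a); apply: (perm_trans p12).
  by rewrite -(cat1s a p2) perm_catCA.
rewrite -cat1s forest_cat -(cat1s a p2) [RHS]forest_cat subset_convC.
have -> : subset_conv (forest_weight L1) (forest_weight [:: a]) B =
  subset_conv (subset_conv (forest_weight p1) (forest_weight p2)) (forest_weight [:: a]) B.
  by apply: eq_subset_conv => // S _; rewrite (IH _ _ p12') forest_cat.
by rewrite subset_convA; apply: eq_subset_conv => // S _; rewrite forest_cat subset_convC.
Qed.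

Lemma perm_enum_setU1 b S : b \notin S -> perm_eq (enum (b |: S)) (b :: enum S).
Proof.
move=> bS; apply: uniq_perm; rewrite ?enum_uniq //= ?mem_enum ?bS ?enum_uniq //.
by move=> x; rewrite !inE !mem_enum !inE.
Qed.

(** A nonempty set that receives no weight from its complement contains no
    child of any explored vertex. *)
Lemma forest_unreached L B (C : {set I}) : C \subset B -> C != set0 ->
  (forall a b, (a \in L) || (a \in B :\: C) -> b \in C -> w a b = 0) ->
  forest_weight L B = 0.
Proof.
have [m] := ubnP (size L + #|B|); elim: m L B => // m IH [|a L] B /=.
  move=> _ CB C0 _; rewrite forest_nil /subset_conv1 (_ : (B == set0) = false) //.
  by apply: contraNF C0 => /eqP B0; rewrite -subset0 -B0.
rewrite addSn ltnS => lt_m CB C0 wC; rewrite forest_cons big1 // => S SB.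
have [dSC|] := boolP [disjoint S & C].
  rewrite IH ?mulr0 //.
  - rewrite size_cat -cardE cardsD (setIidPr SB).
    by have := subset_leq_card SB; move: lt_m; lia.
  - by rewrite subsetD CB disjoint_sym.
  move=> x b Hx; apply: wC; move: Hx; rewrite mem_cat mem_enum !inE.
  case/orP => [/orP[xS|->]|/andP[-> /andP[_ ->]]]; rewrite ?orbT //.
  by rewrite (subsetP SB) // andbT (disjointFr dSC xS) orbT.
rewrite -setI_eq0 => /set0Pn[b]; rewrite inE => /andP[bS bC].
by rewrite (big_setD1 b) //= wC ?mem_head // !mul0r.
Qed.

End ForestWeight.

Section ForestPositive.
Import mathcomp.boot.fintype mathcomp.boot.finset.
Variables (I : finType) (R : realDomainType) (w : I -> I -> R).
Hypothesis w_ge0 : forall a b, 0 <= w a b.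
Implicit Types (L : seq I) (A B C S T : {set I}).

Lemma forest_ge0 L B : 0 <= forest_weight w L B.
Proof.
have [m] := ubnP (size L + #|B|); elim: m L B => // m IH [|a L] B /=.
  by rewrite forest_nil /subset_conv1 ler0n.
rewrite addSn ltnS => lt_m; rewrite forest_cons sumr_ge0 // => S SB.
rewrite mulr_ge0 ?prodr_ge0 // IH //.
rewrite size_cat -cardE cardsD (setIidPr SB).
by have := subset_leq_card SB; move: lt_m; lia.
Qed.

(** The forests on the right in which b is a child of a are those on the left,
    with the edge from a to b restored. *)
Lemma forest_edge a b L B : b \notin B ->
  w a b * forest_weight w (b :: a :: L) B <= forest_weight w (a :: L) (b |: B).
Proof.
move=> bB; rewrite (@perm_forest _ _ _ _ (a :: b :: L)); last first.
  by rewrite -(cat1s b) -(cat1s a) -(cat1s a (b :: L)) -(cat1s b L) perm_catCA.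
rewrite !forest_cons big_subset_setU1 // big_distrr /= ler_sum // => S SB.
have bS : b \notin S by apply: contra bB; apply: subsetP.
rewrite -[leLHS]add0r lerD //.
  by rewrite mulr_ge0 ?prodr_ge0 // forest_ge0.
rewrite big_setU1 //= mulrA ler_wpM2l // ?mulr_ge0 ?prodr_ge0 //.
rewrite le_eqVlt; apply/orP; left; apply/eqP.
have -> : (b |: B) :\: (b |: S) = B :\: S.
  apply/setP => x; rewrite !inE; have [->|_] //= := eqVneq x b.
  by rewrite (negbTE bB) andbF.
apply: perm_forest; apply: (perm_trans (y := b :: (enum S ++ L))).
  by rewrite -cat1s perm_catCA.
by rewrite -cat_cons perm_cat2r perm_sym perm_enum_setU1.
Qed.

Variable M : {set I} -> R.
Hypothesis M0 : M set0 = 1.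
Hypothesis M_le1 : forall A, `|M A| <= 1.
Hypothesis M_indep : forall A B, (forall a b, a \in A -> b \in B -> w a b = 0) ->
  M (A :|: B) = M A * M B.
Hypothesis w_ge1 : forall a b, w a b != 0 -> 1 <= w a b.

(** Induction along [merged_cumulant_setU1] for an edge a - b with nonzero
    weight, hence weight at least 1: each of its two terms is at most 2^(#|B| -
    1) times the weight of the forests containing that edge. Without such an
    edge the cumulant is zero. *)
Theorem merged_cumulant_le_forest A B : A != set0 -> [disjoint A & B] ->
  `|merged_cumulant M A B| <= 2 ^+ #|B| * forest_weight w (enum A) B.
Proof.
have [m] := ubnP #|B|; elim: m A B => // m IH A B; rewrite ltnS => Bm A0 dAB.
have [->|B0] := eqVneq B set0.
  by rewrite merged_cumulant_set0 forest_set0 cards0 mul1r.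
have [/existsP[a /andP[aA /existsP[b /andP[bB wab]]]]|noedge] :=
  boolP [exists a in A, exists b in B, w a b != 0]; last first.
  rewrite merged_cumulant_indep // ?normr0 ?mulr_ge0 ?exprn_ge0 ?forest_ge0 //.
  move=> S SB; apply: M_indep => a b aA bS; apply/eqP.
  apply: contraNT noedge => wab; apply/existsP; exists a; rewrite aA /=.
  by apply/existsP; exists b; rewrite wab (subsetP SB).
rewrite -(setD1K bB); set B' := B :\ b.
have bB' : b \notin B' by rewrite !inE eqxx.
have B'm : (#|B'| < m)%N by move: Bm; rewrite (cardsD1 b B) bB.
have bA : b \notin A by apply/negP => bA; rewrite (disjointFr dAB bA) in bB.
have dAB' : [disjoint A & B'] by apply: disjointWr dAB; apply: subsetDl.
rewrite merged_cumulant_setU1 // cardsU1 bB' exprS -mulrA mulr_natl mulr2n.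
have key : 2 ^+ #|B'| * forest_weight w (b :: enum A) B' <=
    2 ^+ #|B'| * forest_weight w (enum A) (b |: B').
  rewrite ler_wpM2l ?exprn_ge0 //.
  have pA : perm_eq (enum A) (a :: enum (A :\ a)).
    by rewrite -{1}(setD1K aA) perm_enum_setU1 // !inE eqxx.
  rewrite (perm_forest _ _ pA) (@perm_forest _ _ _ _ (b :: a :: enum (A :\ a))); last first.
    by rewrite perm_cons.
  apply: le_trans (forest_edge _ _ bB').
  by rewrite ler_peMl ?forest_ge0 // w_ge1.
apply: le_trans (ler_normB _ _) _; apply: lerD; apply: le_trans key.
  rewrite -(perm_forest _ _ (perm_enum_setU1 bA)); apply: IH => //.
    by apply/set0Pn; exists b; rewrite setU11.
  by rewrite disjoints_subset subUset sub1set -disjoints_subset dAB' andbT inE.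
rewrite (@perm_forest _ _ _ _ (enum A ++ [:: b])); last by rewrite -cat1s perm_catC.
rewrite forest_cat /subset_conv big_distrr /=; apply: le_trans (ler_norm_sum _ _ _) _.
apply: ler_sum => S SB'; rewrite normrM.
have cSB := subset_leq_card SB'.
have -> : 2 ^+ #|B'| = 2 ^+ #|S| * 2 ^+ #|B' :\: S| :> R.
  by rewrite -exprD cardsD (setIidPr SB') subnKC.
rewrite mulrACA; apply: ler_pM => //; last rewrite -(enum_set1 b).
  apply: IH => //; first by apply: leq_ltn_trans cSB B'm.
  by apply: disjointWr dAB'.
apply: IH.
- by apply: leq_ltn_trans B'm; apply: subset_leq_card; apply: subsetDl.
- by apply/set0Pn; exists b; rewrite set11.
- by rewrite disjoints1 inE (negbTE bB') andbF.
Qed.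

End ForestPositive.

Section ForestCayley.
Import mathcomp.boot.fintype mathcomp.boot.finset.
Variables (I : finType) (R : realDomainType).
Implicit Types (L : seq I) (A B C S T : {set I}).

(** The binomial theorem, sorted by subsets rather than by their sizes. *)
Lemma sum_subset_exp (x y : R) B :
  \sum_(S : {set I} | S \subset B) x ^+ #|S| * y ^+ #|B :\: S| = (x + y) ^+ #|B|.
Proof.
have [m] := ubnP #|B|; elim: m B => // m IH B; rewrite ltnS => Bm.
have [->|/set0Pn[b bB]] := eqVneq B set0.
  by rewrite (big_pred1 set0) ?setD0 ?cards0 ?mulr1 // => S; rewrite subset0.
rewrite -(setD1K bB); set B' := B :\ b.
have bB' : b \notin B' by rewrite !inE eqxx.
have B'm : (#|B'| < m)%N by move: Bm; rewrite (cardsD1 b B) bB.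
rewrite big_subset_setU1 // cardsU1 bB' exprS -IH // mulr_sumr.
apply: eq_bigr => S SB; have bS : b \notin S by apply: contra bB'; apply: subsetP.
rewrite cardsU1 bS.
have -> : (b |: B') :\: (b |: S) = B' :\: S.
  apply/setP => x0; rewrite !inE; have [->|_] //= := eqVneq x0 b.
  by rewrite andbF.
have -> : (b |: B') :\: S = b |: (B' :\: S).
  by rewrite setDUl; congr (_ :|: _); apply/setDidPl; rewrite disjoints1.
rewrite cardsU1 !inE eqxx andbF !exprS; ring.
Qed.

Variables (k c : I -> R).

(** The derivative of the binomial theorem in x, weighted by k; multiplying by
    x + y avoids an exponent #|B| - 1. *)
Lemma sum_subset_exp_weight (x y : R) B :
  (x + y) * \sum_(S : {set I} | S \subset B)
     (\sum_(b in S) k b) * (x ^+ #|S| * y ^+ #|B :\: S|) =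
  (\sum_(b in B) k b) * x * (x + y) ^+ #|B|.
Proof.
under eq_bigr do rewrite big_distrl /=.
rewrite (exchange_big_dep (mem B)) /=; last by move=> S b /subsetP; apply.
rewrite mulr_sumr -mulrA mulr_suml; apply: eq_bigr => b bB.
rewrite (reindex_onto (fun S => b |: S) (fun S => S :\ b)) /=; last first.
  by move=> S /andP[_ bS]; rewrite setD1K.
rewrite (eq_bigl (fun S : {set I} => S \subset B :\ b)); last first.
  move=> S; rewrite setU11 andbT subsetD1 subUset sub1set bB /=; congr (_ && _).
  apply/eqP/idP => [<-|iS]; first by rewrite !inE eqxx.
  by rewrite setU1K.
rewrite (cardsD1 b B) bB exprS -sum_subset_exp !mulr_sumr.
apply: eq_bigr => S SB; have bS : b \notin S.
  by apply/negP => /(subsetP SB); rewrite !inE eqxx.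
by rewrite cardsU1 bS exprS setDDl; ring.
Qed.

Hypothesis k_gt0 : forall i, 0 < k i.

(** Cayley's formula with vertex weights. It is multiplied by the total weight
    so that the exponent is #|B| also when B is empty. *)
Theorem forest_Cayley L B :
  forest_weight (fun a b => k a * c b) L B * (\sum_(a <- L) k a + \sum_(b in B) k b) =
  (\sum_(a <- L) k a) * (\sum_(a <- L) k a + \sum_(b in B) k b) ^+ #|B| *
  \prod_(b in B) c b.
Proof.
have [m] := ubnP (size L + #|B|); elim: m L B => // m IH [|a L] B /=.
  rewrite forest_nil big_nil !mul0r add0r /subset_conv1 => _.
  by have [->|] := eqVneq B set0; rewrite ?big_set0 ?mulr0 ?mul0r.
rewrite addSn ltnS big_cons => lt_m.
set kL := \sum_(a <- L) _; set kB := \sum_(b in B) _.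
have kL0 : 0 <= kL by apply: sumr_ge0 => i _; apply: ltW.
have kB0 : 0 <= kB by apply: sumr_ge0 => i _; apply: ltW.
(* The weight kL + kB is cancelled below; when it is 0, B is empty. *)
have [K0|K0] := eqVneq (kL + kB) 0.
  have kB00 : kB = 0 by lra.
  have B0 : B = set0.
    apply/eqP; apply: contraTT (k_gt0 a) => /set0Pn[b bB].
    have : 0 < kB by rewrite /kB (big_setD1 b) //= ltr_pwDl // sumr_ge0 // => i _; apply: ltW.
    by rewrite kB00 ltxx.
  rewrite kB00 addr0 B0 forest_set0 cards0 big_set0; ring.
apply: (mulIf K0).
have step : forest_weight (fun a b => k a * c b) (a :: L) B * (kL + kB) =
    (\prod_(b in B) c b) * (kL * (k a + (kL + kB)) ^+ #|B| +
     \sum_(S : {set I} | S \subset B) (\sum_(b in S) k b) *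
       (k a ^+ #|S| * (kL + kB) ^+ #|B :\: S|)).
  rewrite forest_cons mulr_suml -sum_subset_exp mulr_sumr -big_split /= mulr_sumr.
  apply: eq_bigr => S SB.
  have kBS : kB = \sum_(b in S) k b + \sum_(b in B :\: S) k b.
    by rewrite /kB (big_setID S) /= (setIidPr SB).
  have := IH (enum S ++ L) (B :\: S); rewrite big_cat /= -/kL big_enum /=.
  have -> : \sum_(b in S) k b + kL + \sum_(b in B :\: S) k b = kL + kB.
    by rewrite kBS; ring.
  rewrite -[in X in _ -> X]mulrA => ->; last first.
    rewrite size_cat -cardE cardsD (setIidPr SB).
    by have := subset_leq_card SB; move: lt_m; lia.
  rewrite big_split /= prodr_const [\prod_(b in B) _](big_setID S) /= (setIidPr SB).
  ring.
rewrite mulrAC step.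
have := sum_subset_exp_weight (k a) (kL + kB) B; rewrite -/kB.
set W := \sum_(S | _) _; rewrite -?(addrA (k a)).
set K := k a + (kL + kB) => HW; have defK : K = k a + (kL + kB) by [].
clearbody K; transitivity ((\prod_(b in B) c b) * (kL * K ^+ #|B| * K + K * W)); first ring.
rewrite HW; move: (K ^+ _) => E; rewrite defK; ring.
Qed.

End ForestCayley.

(** * Sums over all maps of the vertices *)

Section MapSums.
Import mathcomp.boot.fintype mathcomp.boot.finset mathcomp.boot.finfun.
Variables (V T : finType) (W : {set T}) (R : realFieldType).
Implicit Types (phi psi : {ffun V -> T}) (h : {ffun V -> T} -> R) (D : {set V}).

Definition depends_on D h := forall phi psi, {in D, phi =1 psi} -> h phi = h psi.

Lemma depends_on_sub D D' h : D \subset D' -> depends_on D h -> depends_on D' h.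
Proof. by move=> /subsetP DD' hD phi psi e; apply: hD => x /DD'; apply: e. Qed.

Lemma depends_onM D h1 h2 : depends_on D h1 -> depends_on D h2 ->
  depends_on D (fun phi => h1 phi * h2 phi).
Proof. by move=> d1 d2 phi psi e; rewrite (d1 _ _ e) (d2 _ _ e). Qed.

Lemma depends_on_prod (J : finType) (P : {set J}) D (h : J -> {ffun V -> T} -> R) :
  (forall j, j \in P -> depends_on D (h j)) ->
  depends_on D (fun phi => \prod_(j in P) h j phi).
Proof. by move=> d phi psi e; apply: eq_bigr => j jP; apply: d. Qed.

Definition glue D phi psi := [ffun x => if x \in D then phi x else psi x].

Local Notation maps := (@ffun_on_mem V T (mem W)).

Lemma glue_maps D phi psi : phi \in maps -> psi \in maps -> glue D phi psi \in maps.
Proof.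
move=> /ffun_onP Hphi /ffun_onP Hpsi; apply/ffun_onP => x; rewrite ffunE.
by case: ifP.
Qed.

Lemma sum_maps1 : \sum_(phi in maps) (1 : R) = #|W|%:R ^+ #|V|.
Proof. by rewrite sumr_const card_ffun_on natrX. Qed.

(** Fubini for functions of disjoint groups of coordinates: exchanging the
    values on D of a pair of maps is an involution of the pairs, and it carries
    h1 of one map and h2 of the other to h1 and h2 of the same map. *)
Lemma sum_mapsM D h1 h2 : depends_on D h1 -> depends_on (~: D) h2 ->
  #|W|%:R ^+ #|V| * \sum_(phi in maps) h1 phi * h2 phi =
  (\sum_(phi in maps) h1 phi) * \sum_(phi in maps) h2 phi.
Proof.
move=> d1 d2; rewrite -sum_maps1 mulrC !big_distrlr /= !pair_big /=.
pose sw (p : {ffun V -> T} * {ffun V -> T}) := (glue D p.1 p.2, glue D p.2 p.1).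
have swK : involutive sw.
  by move=> [p q]; congr (_, _); apply/ffunP => x; rewrite !ffunE /= ; case: (x \in D).
have sw_maps p : (p.1 \in maps) && (p.2 \in maps) ->
    ((sw p).1 \in maps) && ((sw p).2 \in maps).
  by case/andP => p1 p2; rewrite !glue_maps.
rewrite [LHS](reindex_inj (inv_inj swK)) /=.
apply: eq_big => [p|p _].
  by apply/idP/idP => [H|/sw_maps//]; have := @sw_maps (sw p) H; rewrite swK.
rewrite mulr1; congr (_ * _).
  by apply: d1 => x xD; rewrite ffunE xD.
by apply: d2 => x; rewrite inE => /negbTE xD; rewrite ffunE xD.
Qed.

(** Given the other coordinates, the value at y is uniform in W; the proof
    exchanges it with a fresh uniform value v. *)
Lemma sum_maps_match h (x y : V) : x != y -> depends_on [set~ y] h ->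
  #|W|%:R * \sum_(phi in maps) h phi * (phi x == phi y)%:R =
  \sum_(phi in maps) h phi.
Proof.
move=> xy hy.
have -> : #|W|%:R = \sum_(v in W) 1 :> R by rewrite sumr_const.
rewrite mulrC big_distrlr /= pair_big /=.
pose upd (p : {ffun V -> T} * T) : {ffun V -> T} * T :=
  ([ffun z => if z == y then p.2 else p.1 z], p.1 y).
have updK : involutive upd.
  move=> [p v]; congr (_, _); last by rewrite ffunE eqxx.
  by apply/ffunP => z; rewrite !ffunE /=; case: eqP => // ->.
have upd_maps p : (p.1 \in maps) && (p.2 \in W) -> ((upd p).1 \in maps) && ((upd p).2 \in W).
  case/andP => /ffun_onP p1 p2; rewrite /= p1 andbT; apply/ffun_onP => z.
  by rewrite ffunE; case: ifP.
transitivity (\sum_(p | (p.1 \in maps) && (p.2 \in W)) h p.1 * (p.1 x == p.2)%:R).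
  rewrite (reindex_inj (inv_inj updK)) /=; apply: eq_big => [p|p _].
    by apply/idP/idP => [H|/upd_maps//]; have := @upd_maps (upd p) H; rewrite updK.
  rewrite mulr1 !ffunE eqxx (negbTE xy); congr (_ * _).
  by apply: hy => z; rewrite !inE ffunE => /negbTE ->.
rewrite -(pair_big (fun phi => phi \in maps) (fun v => v \in W)
  (fun phi v => h phi * (phi x == v)%:R)) /=.
apply: eq_bigr => phi /ffun_onP phiW; rewrite (bigD1 (phi x)) //= eqxx mulr1.
rewrite big1 ?addr0 // => v /andP[_ /negbTE]; rewrite eq_sym => ->.
by rewrite mulr0.
Qed.

End MapSums.

Section BlockMaps.
Import mathcomp.boot.fintype mathcomp.boot.finset mathcomp.boot.finfun.
Variables (I T : finType) (k : I -> nat) (R : realFieldType).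
Definition vertices : finType := {i : I & 'I_(k i)}.
Implicit Types (phi psi : {ffun vertices -> T}) (A B S : {set I}) (L : seq I).

Definition vtx i (a : 'I_(k i)) : vertices := Tagged (fun i => 'I_(k i)) a.

Definition block B : {set vertices} := [set v | tag v \in B].

(** A coincidence is counted once for each pair of vertices realizing it, so
    that the sum over all maps has a closed form. *)
Definition matches phi i j : R :=
  \sum_(a < k i) \sum_(b < k j) (phi (vtx a) == phi (vtx b))%:R.

Lemma card_vertices : #|vertices| = (\sum_i k i)%N.
Proof. by rewrite card_tagged sumnE big_map big_enum; apply: eq_bigr => i _;
  rewrite card_ord. Qed.

Variables (W : {set T}) (W_neq0 : W != set0).
Local Notation maps := (@ffun_on_mem vertices T (mem W)).

Let cW : #|W|%:R != 0 :> R. Proof. by rewrite pnatr_eq0 cards_eq0. Qed.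

(** Each of the k i * k j pairs of vertices coincides with frequency 1 /
    #|W|. *)
Definition mean_matches i j : R := (k i)%:R * ((k j)%:R / #|W|%:R).

Lemma depends_on_matches a b B : a \in B -> b \in B ->
  depends_on (block B) (fun phi => matches phi a b).
Proof.
move=> aB bB phi psi e; apply: eq_bigr => x _; apply: eq_bigr => y _.
by rewrite !e // inE.
Qed.

Lemma sum_matches a b h : a != b -> depends_on (~: block [set b]) h ->
  \sum_(phi in maps) h phi * matches phi a b =
  \sum_(phi in maps) h phi * mean_matches a b.
Proof.
move=> ab hb; apply: (mulfI cW).
have E phi : h phi * matches phi a b =
    \sum_(x < k a) \sum_(y < k b) h phi * (phi (vtx x) == phi (vtx y))%:R.
  by rewrite mulr_sumr; apply: eq_bigr => x _; rewrite mulr_sumr.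
rewrite (eq_bigr _ (fun phi _ => E phi)) exchange_big mulr_sumr /=.
transitivity (\sum_(x < k a) \sum_(y < k b) \sum_(phi in maps) h phi).
  apply: eq_bigr => x _; rewrite exchange_big mulr_sumr; apply: eq_bigr => y _ /=.
  rewrite sum_maps_match //; first by apply: contra ab => /eqP/(congr1 tag) /= ->.
  apply: depends_on_sub hb; apply/subsetP => z; rewrite !inE.
  by apply: contra => /eqP ->.
rewrite !sumr_const !card_ord -mulr_suml /mean_matches -mulr_natr -mulr_natr.
rewrite [_ / _]mulrC !mulrA; move: (\sum_(i in _) _) => H; field.
exact: cW.
Qed.

Lemma sum_prod_matches a S h : a \notin S -> depends_on (~: block S) h ->
  \sum_(phi in maps) h phi * \prod_(b in S) matches phi a b =
  \sum_(phi in maps) h phi * \prod_(b in S) mean_matches a b.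
Proof.
have [m] := ubnP #|S|; elim: m S h => // m IH S h; rewrite ltnS => Sm.
have [->|/set0Pn[b bS]] := eqVneq S set0.
  by move=> _ _; apply: eq_bigr => phi _; rewrite !big_set0.
move=> aS hS; have ab : a != b by apply: contraNneq aS => ->.
have S'm : (#|S :\ b| < m)%N by move: Sm; rewrite (cardsD1 b S) bS.
transitivity (\sum_(phi in maps) (h phi * matches phi a b) *
  \prod_(j in S :\ b) matches phi a j).
  by apply: eq_bigr => phi _; rewrite (big_setD1 b) //= mulrA.
rewrite IH //; first last.
- apply: depends_onM.
    by apply: depends_on_sub hS; apply/subsetP => x; rewrite !inE negb_and => ->; rewrite orbT.
  apply: (depends_on_sub (D := block [set a; b])); last by apply: depends_on_matches;
    rewrite !inE eqxx ?orbT.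
  apply/subsetP => x; rewrite !inE => /orP[/eqP ->|->]//.
  by rewrite (negbTE aS) andbF.
- by rewrite !inE negb_and aS orbT.
transitivity (\sum_(phi in maps)
    (h phi * \prod_(j in S :\ b) mean_matches a j) * matches phi a b).
  by apply: eq_bigr => phi _; rewrite mulrAC.
rewrite sum_matches //.
  by apply: eq_bigr => phi _; rewrite [in RHS](big_setD1 b) //= [RHS]mulrA [RHS]mulrAC.
apply: depends_onM; last by [].
by apply: depends_on_sub hS; apply/subsetP => x; rewrite !inE; apply: contra => /eqP ->.
Qed.

(** The exploration attaches the blocks of B one after the other; when a block
    is attached its values have not been read yet, so each factor may be
    replaced by its mean. *)
Lemma sum_forest L B h : (forall a, a \in L -> a \notin B) ->
  depends_on (~: block B) h ->
  \sum_(phi in maps) h phi * forest_weight (matches phi) L B =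
  \sum_(phi in maps) h phi * forest_weight mean_matches L B.
Proof.
have [m] := ubnP (size L + #|B|); elim: m L B h => // m IH [|a L] B h /=.
  by move=> _ _ _; apply: eq_bigr => phi _; rewrite !forest_nil.
rewrite addSn ltnS => lt_m LB hB.
under eq_bigr do rewrite forest_cons big_distrr /=.
under [RHS]eq_bigr do rewrite forest_cons big_distrr /=.
rewrite exchange_big [RHS]exchange_big /=; apply: eq_bigr => S SB.
have aS : a \notin S by apply: contra (LB a (mem_head _ _)); apply: subsetP.
under eq_bigr do rewrite mulrA.
rewrite IH; first last.
- apply: depends_onM.
    by apply: depends_on_sub hB; apply/subsetP => x; rewrite !inE negb_and => ->; rewrite orbT.
  apply: (depends_on_sub (D := block (a |: S))).
    apply/subsetP => x; rewrite !inE => /orP[/eqP ->|->] //.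
    by rewrite (negbTE (LB a _)) ?mem_head ?andbF.
  apply: depends_on_prod => b bS; apply: depends_on_matches; rewrite !inE ?eqxx //.
  by rewrite bS orbT.
- move=> x; rewrite mem_cat mem_enum inE negb_and negbK => /orP[->//|xL].
  by rewrite LB ?orbT // inE xL orbT.
- rewrite size_cat -cardE cardsD (setIidPr SB).
  by have := subset_leq_card SB; move: lt_m; lia.
rewrite -mulr_suml sum_prod_matches //.
  by rewrite mulr_suml; apply: eq_bigr => phi _; rewrite mulrA.
apply: depends_on_sub hB; apply/subsetP => x; rewrite !inE; apply: contra.
exact: (subsetP SB).
Qed.

Hypothesis k_gt0 : forall i, (0 < k i)%N.

(** The tree counts of all maps: s - 1 coincidences leave #|W| to the power K -
    (s - 1), and [forest_Cayley] counts the trees. *)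
Theorem sum_forest_tree i0 (s := #|I|) (K := (\sum_i k i)%N) : (1 < s)%N ->
  \sum_(phi in maps) forest_weight (matches phi) [:: i0] [set~ i0] =
  (\prod_i k i)%:R * K%:R ^+ (s - 2) * #|W|%:R ^+ (K - (s - 1)) :> R.
Proof.
move=> s1.
have sK : (s <= K)%N by rewrite /s -sum1_card leq_sum.
rewrite (eq_bigr (fun phi => 1 * forest_weight (matches phi) [:: i0] [set~ i0])); last first.
  by move=> phi _; rewrite mul1r.
rewrite (@sum_forest _ _ (fun=> 1)) //; last first.
  by move=> a; rewrite !inE => /eqP ->; rewrite eqxx.
rewrite sumr_const card_ffun_on card_vertices -/K mul1r -[LHS]mulr_natl natrX.
have K0 : K%:R != 0 :> R by rewrite pnatr_eq0; lia.
have k0 i : 0 < (k i)%:R :> R by rewrite ltr0n.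
have := forest_Cayley (fun j => (k j)%:R / #|W|%:R) k0 [:: i0] [set~ i0].
rewrite big_seq1.
have -> : (k i0)%:R + \sum_(b in [set~ i0]) (k b)%:R = K%:R :> R.
  rewrite /K [in RHS](bigD1 i0) //= natrD natr_sum; congr (_ + _); apply: eq_bigl => j.
  by rewrite !inE.
have cI : #|[set~ i0]| = (s - 1)%N by have := cardsC1 i0; rewrite /s; lia.
rewrite cI big_split /= prodr_const cI => eqF; apply: (mulIf K0).
rewrite -[forest_weight _ _ _]/(forest_weight mean_matches [:: i0] [set~ i0]) in eqF.
rewrite -[LHS]mulrA eqF.
have -> : (\prod_i k i)%:R = (k i0)%:R * \prod_(i in [set~ i0]) (k i)%:R :> R.
  rewrite (bigD1 i0) //= natrM natr_prod; congr (_ * _); apply: eq_bigl => j.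
  by rewrite !inE.
have -> : K%:R ^+ (s - 1) = K%:R ^+ (s - 2) * K%:R :> R.
  by rewrite -exprSr; congr (_ ^+ _); lia.
have -> : #|W|%:R ^+ K = #|W|%:R ^+ (K - (s - 1)) * #|W|%:R ^+ (s - 1) :> R.
  by rewrite -exprD; congr (_ ^+ _); lia.
set P := \prod_(i in _) _; set w := _ ^+ (K - _); set KK := _ ^+ (s - 2).
have ww : #|W|%:R ^+ (s - 1) * (#|W|%:R^-1) ^+ (s - 1) = 1 :> R.
  by rewrite -exprMn mulfV // expr1n.
move: (_ ^+ (s - 1)) (_ ^+ (s - 1)) ww => u v vu.
transitivity ((k i0)%:R * P * KK * w * K%:R * (v * u)); first ring.
by rewrite vu mulr1.
Qed.

End BlockMaps.

(** * Cancellation over tree-like maps, and the bound it leaves *)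

Section AbstractBound.
Import mathcomp.boot.fintype mathcomp.boot.finset mathcomp.boot.finfun.
Variables (I T : finType) (k : I -> nat) (R : realFieldType).
Local Notation V := (vertices k).
Local Notation matches := (@matches I T k R).
Implicit Types (phi psi : {ffun V -> T}) (A B S : {set I}) (L : seq I).

Definition values phi B : {set T} := [set phi v | v in block k B].

Lemma values_disjoint phi i j : matches phi i j = 0 ->
  forall t, t \in values phi [set i] -> t \in values phi [set j] -> false.
Proof.
move=> m0 t /imsetP[[i' a]]; rewrite !inE /= => /eqP ii; subst i' => ->.
move=> /imsetP[[j' b]]; rewrite !inE /= => /eqP jj; subst j' => eqt.
move: m0 => /eqP; rewrite psumr_eq0; last by move=> x _; apply: sumr_ge0 => y _; rewrite ler0n.
move=> /allP/(_ a); rewrite mem_index_enum => /(_ isT) /=.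
rewrite psumr_eq0; last by move=> y _; rewrite ler0n.
move=> /allP/(_ b); rewrite mem_index_enum => /(_ isT) /=.
by rewrite /vtx eqt eqxx oner_eq0.
Qed.

Lemma values_match phi i j : matches phi i j != 0 ->
  exists2 t, t \in values phi [set i] & t \in values phi [set j].
Proof.
move=> m0; have /existsP[a /existsP[b /eqP e]] :
    [exists a : 'I_(k i), exists b : 'I_(k j), phi (vtx a) == phi (vtx b)].
  apply: contraNT m0 => /existsPn H; apply/eqP; rewrite /matches big1 // => a _.
  rewrite big1 // => b _; case: eqP => // e.
  by have /existsPn/(_ b) := H a; rewrite e eqxx.
exists (phi (vtx a)); first by apply: imset_f; rewrite !inE.
by rewrite e; apply: imset_f; rewrite !inE.
Qed.

Lemma matches_ge0 phi i j : 0 <= matches phi i j.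
Proof. by apply: sumr_ge0 => a _; apply: sumr_ge0 => b _; rewrite ler0n. Qed.

Lemma matches_ge1 phi i j : matches phi i j != 0 -> 1 <= matches phi i j.
Proof.
move=> m0.
have e : matches phi i j = (\sum_(a < k i) \sum_(b < k j) (phi (vtx a) == phi (vtx b)))%:R.
  by rewrite natr_sum; apply: eq_bigr => a _; rewrite natr_sum.
by move: m0; rewrite e pnatr_eq0 ler1n lt0n.
Qed.

Lemma valuesU phi A B : values phi (A :|: B) = values phi A :|: values phi B.
Proof.
rewrite /values -imsetU (_ : block k (A :|: B) = block k A :|: block k B) //.
by apply/setP => v; rewrite !inE.
Qed.

Lemma values_sub phi i B t : i \in B -> t \in values phi [set i] -> t \in values phi B.
Proof.
move=> iB /imsetP[v]; rewrite !inE => /eqP vi ->.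
by apply: imset_f; rewrite inE vi.
Qed.

Lemma vtx_inj i : injective (@vtx I k i).
Proof. by move=> a b /eqP; rewrite -tag_eqE /tag_eq eqxx /= tagged_asE => /eqP. Qed.

Lemma card_block1 i : #|block k [set i]| = k i.
Proof.
have -> : block k [set i] = [set vtx a | a : 'I_(k i)].
  apply/setP => -[j a]; rewrite !inE /=; apply/eqP/imsetP => [e|[b _ /(congr1 tag)]] //.
  by subst j; exists a.
by rewrite card_imset ?card_ord //; apply: vtx_inj.
Qed.

Lemma card_values1 phi i : (#|values phi [set i]| <= k i)%N.
Proof. by rewrite -(card_block1 i) leq_imset_card. Qed.

Variable i0 : I.
Local Notation tree phi := (forest_weight (matches phi) [:: i0] [set~ i0]).
Local Notation s := #|I|.
Local Notation K := (\sum_i k i)%N.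

(** A block outside S can only be reached from S through a coincidence. *)
Lemma tree_neighbor phi S : tree phi != 0 -> i0 \in S -> S != setT ->
  exists a b, [/\ a \in S, b \notin S & matches phi a b != 0].
Proof.
move=> t0 i0S ST.
have [/existsP[a /existsP[b /and3P[? ? ?]]]|noedge] :=
  boolP [exists a, exists b, [&& a \in S, b \notin S & matches phi a b != 0]].
  by exists a, b.
case/negP: t0; apply/eqP; apply: (@forest_unreached _ _ _ _ _ (~: S)).
- by rewrite setCS sub1set.
- by apply: contra ST => /eqP SC; rewrite -(setCK S) SC setC0.
move=> a b Ha; rewrite inE => bS; apply/eqP; apply: contraNT noedge => m0.
apply/existsP; exists a; apply/existsP; exists b; rewrite m0 bS !andbT.
by move: Ha; rewrite !inE negbK => /orP[/eqP ->|/andP[]].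
Qed.

(** Adding to S a block that shares a value with it brings at most k i - 1 new
    values. *)
Lemma tree_grow phi m : tree phi != 0 -> (0 < m <= s)%N ->
  exists S, [/\ i0 \in S, #|S| = m & (#|values phi S| + m <= \sum_(i in S) k i + 1)%N].
Proof.
move=> t0; elim: m => // -[_|m IH] ms.
  exists [set i0]; rewrite set11 cards1 big_set1 leq_add2r card_values1; split=> //.
have [|S [i0S cS le_m]] := IH; first by rewrite /= ltnW.
have [|a [b [aS bS /values_match[t ta tb]]]] := tree_neighbor t0 i0S.
  by apply: contraTneq ms => ST; rewrite -cS ST cardsT; rewrite ltnn.
exists (b |: S); rewrite !inE i0S orbT cardsU1 bS cS; split=> //.
rewrite big_setU1 //= valuesU.
have := cardsUI (values phi [set b]) (values phi S).
have : (0 < #|values phi [set b] :&: values phi S|)%N.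
  by rewrite card_gt0; apply/set0Pn; exists t; rewrite inE tb (values_sub aS).
by have := card_values1 phi b; lia.
Qed.

Lemma card_values_tree phi : tree phi != 0 -> (0 < s)%N -> (#|values phi setT| + s <= K + 1)%N.
Proof.
move=> t0 s0; have [|S [_ cS]] := tree_grow (m := s) t0; first by rewrite s0 /=.
have -> : S = setT by apply/eqP; rewrite eqEcard subsetT cardsT cS /=.
by rewrite (eq_bigl predT) // => i; rewrite inE.
Qed.

(** The first condition says that phi is injective on block i. *)
Definition leaf phi i :=
  (#|values phi [set i]| == k i) && (#|values phi [set i] :&: values phi [set~ i]| == 1)%N.

(** In a growth sequence adding one block at a time, the last block is a leaf
    when the image is as large as it can be. *)
Lemma tree_leaf phi : (1 < s)%N -> tree phi != 0 ->
  (#|values phi setT| + s = K + 1)%N -> exists i, leaf phi i.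
Proof.
move=> s1 t0 cim.
have [|S [i0S cS le_s]] := tree_grow (m := s.-1) t0; first by lia.
have /card_gt0P[i] : (0 < #|~: S|)%N by have := cardsC S; rewrite cS; lia.
rewrite inE => iS.
have defS : S = [set~ i].
  apply/eqP; rewrite eqEcard; apply/andP; split.
    by apply/subsetP => j jS; rewrite !inE; apply: contraNneq iS => <-.
  by rewrite cS; have := cardsC1 i; lia.
exists i; rewrite /leaf -defS.
have [|a [b [aS bS /values_match[t ta tb]]]] := tree_neighbor t0 i0S.
  by apply: contraNneq iS => ->; rewrite inE.
have bi : b = i by apply/eqP; move: bS; rewrite defS !inE negbK.
subst b.
have : (0 < #|values phi [set i] :&: values phi S|)%N.
  by rewrite card_gt0; apply/set0Pn; exists t; rewrite inE tb (values_sub aS).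
have := cardsUI (values phi [set i]) (values phi S); rewrite -valuesU.
have -> : i |: S = setT by rewrite defS setUCr.
have := card_values1 phi i.
move: cim; have -> : K = (k i + \sum_(j in S) k j)%N.
  by rewrite (bigD1 i) //=; congr (_ + _)%N; apply: eq_bigl => j; rewrite defS !inE.
move: le_s; lia.
Qed.

Variable M : {ffun V -> T} -> {set I} -> R.
Hypothesis M0 : forall phi, M phi set0 = 1.
Hypothesis M_le1 : forall phi A, `|M phi A| <= 1.
Hypothesis M_indep : forall phi A B,
  (forall t, t \in values phi A -> t \in values phi B -> false) ->
  M phi (A :|: B) = M phi A * M phi B.
Hypothesis M_dep : forall B, depends_on (block k B) (fun phi => M phi B).

Definition swap_vtx phi x y : {ffun V -> T} := [ffun v => phi (tperm x y v)].

Variable c : I -> R.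
Hypothesis M_leaf : forall phi i (a0 : 'I_(k i)), leaf phi i ->
  phi (vtx a0) \in values phi [set~ i] -> forall S, i \notin S ->
  \sum_(a < k i) M (swap_vtx phi (vtx a0) (vtx a)) (i |: S) = c i * M phi S.

Definition kappa phi := \sum_(pi : {set {set I}} | partition pi [set: I])
    (-1) ^+ (#|pi| - 1) * ((#|pi| - 1)`!)%:R * \prod_(S in pi) M phi S.

Lemma kappa_root phi i : kappa phi = merged_cumulant (M phi) [set i] [set~ i].
Proof. by rewrite /kappa (cumulant_root _ (in_setT i)) setTD. Qed.

(** Blocks without coincidence have disjoint images, hence independent
    events. *)
Lemma kappa_le phi : `|kappa phi| <= 2 ^+ (s - 1) * tree phi.
Proof.
rewrite (kappa_root _ i0) -(enum_set1 i0).
have -> : (s - 1)%N = #|[set~ i0]| by have := cardsC1 i0; lia.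
apply: merged_cumulant_le_forest => //.
- by move=> a b; apply: matches_ge0.
- move=> A B AB; apply: M_indep => t /imsetP[u]; rewrite inE => uA -> /imsetP[v].
  rewrite inE => vB e; apply: (values_disjoint (AB _ _ uA vB) (t := phi u)).
    by apply: imset_f; rewrite !inE.
  by rewrite e; apply: imset_f; rewrite !inE.
- by move=> a b; apply: matches_ge1.
- by apply/set0Pn; exists i0; rewrite set11.
- by rewrite disjoints1 !inE eqxx.
Qed.

Lemma values_swap_vtx phi i (a b : 'I_(k i)) B :
  values (swap_vtx phi (vtx a) (vtx b)) B = values phi B.
Proof.
have sub psi : values (swap_vtx psi (vtx a) (vtx b)) B \subset values psi B.
  apply/subsetP => t /imsetP[v]; rewrite inE => vB ->; rewrite ffunE.
  by apply: imset_f; rewrite inE; case: tpermP vB => // ->.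
apply/eqP; rewrite eqEsubset sub /=.
have {1}-> : phi = swap_vtx (swap_vtx phi (vtx a) (vtx b)) (vtx a) (vtx b).
  by apply/ffunP => v; rewrite !ffunE tpermK.
exact: sub.
Qed.

(** With root i, the factor M^-1 only involves the other blocks and does not
    feel the swaps, so summing over a turns M(i u .) into c i times M, and M *
    M^-1 vanishes on nonempty sets. *)
Lemma leaf_sum0 phi i (a0 : 'I_(k i)) : (1 < s)%N -> leaf phi i ->
  phi (vtx a0) \in values phi [set~ i] ->
  \sum_(a < k i) kappa (swap_vtx phi (vtx a0) (vtx a)) = 0.
Proof.
move=> s1 lf att.
have rest0 : [set~ i] != set0 by rewrite -card_gt0; have := cardsC1 i; lia.
have eM (a : 'I_(k i)) S : S \subset [set~ i] -> M (swap_vtx phi (vtx a0) (vtx a)) S = M phi S.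
  move=> Si; apply: M_dep => v; rewrite inE ffunE => vS.
  case: tpermP vS => // -> /(subsetP Si); rewrite !inE eqxx //.
have -> : \sum_(a < k i) kappa (swap_vtx phi (vtx a0) (vtx a)) =
    \sum_(a < k i) subset_conv (fun S => M (swap_vtx phi (vtx a0) (vtx a)) (i |: S))
      (subset_conv_inv (M phi)) [set~ i].
  apply: eq_bigr => a _; rewrite (kappa_root _ i); apply: eq_subset_conv => // S Si.
  apply: eq_bigr => pi piS; congr (_ * _); apply: eq_bigr => B Bpi.
  by apply: eM; apply: subset_trans Si; apply: partitionS piS Bpi.
rewrite exchange_big /=.
transitivity (c i * subset_conv (M phi) (subset_conv_inv (M phi)) [set~ i]).
  rewrite mulr_sumr; apply: eq_bigr => S Si.
  rewrite -mulr_suml M_leaf ?mulrA //.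
  by apply: contraTN Si => iS; apply/negP => /subsetP/(_ _ iS); rewrite !inE eqxx.
by rewrite subset_convV // /subset_conv1 (negbTE rest0) mulr0.
Qed.

Lemma leaf_attached phi i : leaf phi i ->
  exists a0 : 'I_(k i), forall a : 'I_(k i), (phi (vtx a) \in values phi [set~ i]) = (a == a0).
Proof.
case/andP => /eqP inj /cards1P[t tE].
have phi_inj : {in block k [set i] &, injective phi}.
  by apply/imset_injP; rewrite card_block1; apply/eqP.
have: t \in values phi [set i] :&: values phi [set~ i] by rewrite tE set11.
rewrite inE => /andP[/imsetP[[j a0]]]; rewrite !inE /= => /eqP ji; subst j => ta tC.
exists a0 => a; apply/idP/eqP => [aC|->]; last by rewrite -[phi _]ta.
have : phi (vtx a) \in values phi [set i] :&: values phi [set~ i].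
  by rewrite inE aC andbT; apply: imset_f; rewrite !inE.
rewrite tE inE ta => /eqP /phi_inj; rewrite !inE => /(_ (eqxx _) (eqxx _)).
exact: vtx_inj.
Qed.

(** The maps are grouped by their first leaf i. Swapping the vertex of block i
    sitting at the common value with any other one keeps every image, hence the
    group; so the sum over the group breaks into sums covered by
    [leaf_sum0]. *)
Lemma tree_like_sum0 : (1 < s)%N ->
  \sum_(phi | (#|values phi setT| + s == K + 1)%N) kappa phi = 0.
Proof.
move=> s1; rewrite (partition_big (fun phi => [pick i | leaf phi i]) predT) //=.
apply: big1 => -[i|] _; last first.
  apply: big1 => phi /andP[/eqP cim]; case: pickP => // nl _.
  have [t0|/(tree_leaf s1)/(_ cim)[j]] := eqVneq (tree phi) 0; last by rewrite nl.
  by apply/eqP; have := kappa_le phi; rewrite t0 mulr0 normr_le0.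
pose P phi := (#|values phi setT| + s == K + 1)%N && ([pick j | leaf phi j] == Some i).
rewrite -[LHS]/(\sum_(phi | P phi) kappa phi).
have lfP phi : P phi -> leaf phi i by case/andP => _; case: pickP => // j lj /eqP[<-].
have P_swap phi (a b : 'I_(k i)) : P (swap_vtx phi (vtx a) (vtx b)) = P phi.
  rewrite /P values_swap_vtx; congr (_ && (_ == _)); apply: eq_pick => j.
  by rewrite /leaf !values_swap_vtx.
case: (pickP (fun a : 'I_(k i) => true)) => [a0 _|noa]; last first.
  apply: big1 => phi /lfP/leaf_attached[a _]; by have := noa a.
pose att phi (a : 'I_(k i)) := phi (vtx a) \in values phi [set~ i].
transitivity (\sum_(a < k i) \sum_(phi | P phi && att phi a) kappa phi).
  rewrite (exchange_big_dep P) /=; last by move=> a phi _ /andP[].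
  apply: eq_bigr => phi Pphi; have [a1 Ha] := leaf_attached (lfP _ Pphi).
  rewrite (big_pred1 a1) // => a; rewrite Pphi /=; exact: Ha.
transitivity (\sum_(a < k i) \sum_(phi | P phi && att phi a0) kappa
  (swap_vtx phi (vtx a0) (vtx a))).
  apply: eq_bigr => a _.
  have swK : involutive (fun phi => swap_vtx phi (vtx a0) (vtx a)).
    by move=> phi; apply/ffunP => v; rewrite !ffunE tpermK.
  rewrite (reindex_inj (inv_inj swK)) /=; apply: eq_bigl => phi.
  by rewrite P_swap /att values_swap_vtx ffunE tpermR.
rewrite exchange_big /= big1 // => phi /andP[/lfP lf att0].
exact: leaf_sum0.
Qed.

Hypothesis k_gt0 : forall i, (0 < k i)%N.

(** A form of the second Bonferroni inequality for (1 - 1/n)^m, with m^2 in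
    place of m (m - 1) / 2. *)
Lemma pow_pred_le (n : R) m : 1 <= n ->
  n ^+ 2 * (n - 1) ^+ m <= n ^+ m * (n ^+ 2 - m%:R * n + m%:R ^+ 2).
Proof.
move=> n1; elim: m => [|m IH]; first by rewrite !expr0 mul0r expr0n /= subr0 addr0 mulr1 mul1r.
rewrite (exprSr (n - 1)) mulrA.
apply: (le_trans (y := n ^+ m * (n ^+ 2 - m%:R * n + m%:R ^+ 2) * (n - 1))).
  by rewrite ler_wpM2r // subr_ge0.
rewrite (exprSr n m) -!(mulrA (n ^+ m)) ler_wpM2l ?exprn_ge0 //; first lra.
have m0 : 0 <= m%:R :> R by [].
rewrite -natr1; nra.
Qed.

(** The image has n minus #{t not in the image} points, and the maps missing t
    are the maps into the complement of t; both resulting sums are given by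
    [sum_forest_tree]. *)
Lemma sum_tree_excess : (1 < s)%N -> (0 < #|T|)%N ->
  \sum_phi tree phi * ((K - (s - 1))%:R - #|values phi setT|%:R) <=
  (\prod_i k i)%:R * K%:R ^+ s * #|T|%:R ^+ (K - s) :> R.
Proof.
move=> s1 n0; have sK : (s <= K)%N by rewrite -sum1_card leq_sum.
set n := #|T| in n0 *; set c0 := (K - (s - 1))%N; set T0 : R := (\prod_i k i)%:R * K%:R ^+
  (s - 2).
have onT phi : phi \in ffun_on (mem [set: T]) by apply/ffun_onP => v; rewrite inE.
have sumT : \sum_phi tree phi = T0 * n%:R ^+ c0.
  have := @sum_forest_tree I T k R [set: T] _ k_gt0 i0 s1.
  rewrite -card_gt0 cardsT => /(_ n0) <-.
  by apply: eq_bigl => phi; rewrite onT.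
have sumC t : \sum_(phi | t \notin values phi setT) tree phi = T0 * (n.-1)%:R ^+ c0.
  have onC phi : (t \notin values phi setT) = (phi \in ffun_on (mem [set~ t])).
    apply/idP/ffun_onP => [tphi v|H].
      by rewrite !inE; apply: contraNneq tphi => <-; apply: imset_f; rewrite !inE.
    by apply/imsetP => -[v _ e]; have := H v; rewrite !inE -e eqxx.
  rewrite (eq_bigl _ _ onC).
  (* If t is the only point, there are no maps into its complement. *)
  have [W0|W0] := eqVneq [set~ t] set0.
    have -> : n.-1 = 0%N by rewrite -(cardsC1 t) W0 cards0.
    rewrite expr0n (_ : (c0 == 0)%N = false) ?mulr0; last by rewrite /c0; lia.
    apply: big1 => phi /ffun_onP H.
    have v : V by exists i0; apply: Ordinal (k_gt0 i0).
    by have := H v; rewrite W0 inE.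
  by rewrite (sum_forest_tree _ W0 k_gt0 i0 s1) -/T0 -/c0 cardsC1.
have -> : \sum_phi tree phi * (c0%:R - #|values phi setT|%:R) =
    T0 * (n%:R ^+ c0 * c0%:R - n%:R * n%:R ^+ c0 + n%:R * (n.-1)%:R ^+ c0).
  have -> : T0 * (n%:R ^+ c0 * c0%:R - n%:R * n%:R ^+ c0 + n%:R * (n.-1)%:R ^+ c0) =
    (T0 * n%:R ^+ c0) * c0%:R - \sum_(t : T) (T0 * n%:R ^+ c0 - T0 * (n.-1)%:R ^+ c0).
    by rewrite sumr_const -mulr_natl -/n; ring.
  have -> : \sum_(t : T) (T0 * n%:R ^+ c0 - T0 * (n.-1)%:R ^+ c0) =
      \sum_(t : T) \sum_(phi | t \in values phi setT) tree phi.
    apply: eq_bigr => t _; rewrite -(sumC t) -sumT.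
    by rewrite (bigID (fun phi => t \in values phi setT)) /= addrK.
  rewrite -sumT mulr_suml (exchange_big_dep predT) //= -sumrB.
  apply: eq_bigr => phi _; rewrite mulrBr; congr (_ - _).
  by rewrite sumr_const -[RHS]mulr_natr; congr (_ * _%:R); apply: eq_card.
have nn1 : 1 <= n%:R :> R by rewrite ler1n.
have -> : n.-1%:R = n%:R - 1 :> R by rewrite -subn1 natrB.
have -> : (\prod_i k i)%:R * K%:R ^+ s * n%:R ^+ (K - s) = T0 *
  (K%:R ^+ 2 * n%:R ^+ (K - s)) :> R.
  have -> : K%:R ^+ s = K%:R ^+ (s - 2) * K%:R ^+ 2 :> R.
    by rewrite -exprD; congr (_ ^+ _); lia.
  by rewrite /T0 !mulrA.
rewrite ler_wpM2l ?mulr_ge0 ?exprn_ge0 //.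
have pp := @pow_pred_le n%:R c0 nn1.
have nc : n%:R ^+ c0 = n%:R ^+ (K - s) * n%:R :> R by rewrite -exprSr; congr (_ ^+ _);
  rewrite /c0; lia.
have cK : c0%:R <= K%:R :> R by rewrite ler_nat /c0; lia.
move: pp; rewrite nc; set N := n%:R in nn1 *; set E := N ^+ (K - s); set Q := (N - 1) ^+ c0.
have E0 : 0 <= E by rewrite exprn_ge0 //; lra.
move=> pp.
have N0 : 0 < N by lra.
have {pp} : N * Q <= E * (N ^+ 2 - c0%:R * N + c0%:R ^+ 2).
  by rewrite -(ler_pM2l N0) mulrA -expr2; apply: le_trans pp _; lra.
have : c0%:R ^+ 2 * E <= K%:R ^+ 2 * E by rewrite ler_wpM2r // ler_sqr ?nnegrE.
move: (K%:R ^+ 2 * E) => KE; set d := c0%:R; lra.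
Qed.

(** Where the tree count is nonzero, K - (s - 1) - #|image| is a nonnegative
    integer, zero only for maps of maximal image; those contribute nothing by
    [tree_like_sum0], and for the others inserting this factor does no
    harm. *)
Theorem abstract_bound : (1 < s)%N -> (0 < #|T|)%N ->
  `|\sum_phi kappa phi| <=
  2 ^+ (s - 1) * K%:R ^+ s * (\prod_i k i)%:R * #|T|%:R ^+ (K - s).
Proof.
move=> s1 n0; have sK : (s <= K)%N by rewrite -sum1_card leq_sum.
rewrite (bigID (fun phi => (#|values phi setT| + s == K + 1)%N)) /= tree_like_sum0 // add0r.
apply: le_trans (ler_norm_sum _ _ _) _.
have tree_ge0 phi : 0 <= tree phi by apply: forest_ge0 => a b; apply: matches_ge0.
apply: (le_trans (y := \sum_phi 2 ^+ (s - 1) *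
  (tree phi * ((K - (s - 1))%:R - #|values phi setT|%:R)))); last first.
  rewrite -mulr_sumr -!mulrA ler_wpM2l ?exprn_ge0 //.
  by rewrite mulrCA mulrA; apply: sum_tree_excess.
rewrite big_mkcond /=; apply: ler_sum => phi _.
have [t0|t0] := eqVneq (tree phi) 0.
  by have := kappa_le phi; rewrite t0 mul0r !mulr0; case: ifP.
have cim := card_values_tree t0 (ltnW s1).
case: ifPn => [ncim|_].
  apply: le_trans (kappa_le phi) _; rewrite ler_wpM2l ?exprn_ge0 // ler_peMr //.
  move: s1 ncim cim sK; rewrite lerBrDr nat1r ler_nat; clear.
  move: K #|values phi setT| s => p q r; lia.
rewrite !mulr_ge0 ?exprn_ge0 // subr_ge0 ler_nat.
by move: s1 cim sK; clear; move: K #|values phi setT| s => p q r; lia.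
Qed.

End AbstractBound.

(** * The law of a family of independent uniform variables *)

Section TupleLaw.
Local Open Scope classical_set_scope.
Variable R : realType.
Local Notation mR := (measurableTypeR R).

Lemma preimage_tuple0 (Omega : Type) (Y : 'I_0 -> Omega -> R) (B : set (0.-tuple R)) :
  (fun w => [tuple Y i w | i < 0]) @^-1` B = if `[< B [tuple] >] then setT else set0.
Proof.
apply/seteqP; split => w /=; rewrite (tuple0 [tuple Y i w | i < 0]).
  by move=> Bw; rewrite asboolT.
by case: asboolP.
Qed.

Lemma measurable_tuple_of d (Omega : measurableType d) n (Y : 'I_n -> Omega -> R) :
  (forall i, measurable_fun setT (Y i)) ->
  measurable_fun setT (fun w => [tuple Y i w | i < n]).
Proof.
move=> mY; apply/measurable_fun_tnthP => i.
rewrite (_ : _ \o _ = Y i) //; apply/funext => w /=; exact: tnth_mktuple.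
Qed.

(** The induction peels off the first variable by restricting Q to an event
    about it; the constant c is there because the restricted measure is no
    longer a probability. *)
Lemma tuple_law d (Omega : measurableType d) n (Q : {measure set Omega -> \bar R})
    (Y : 'I_n -> Omega -> R) (c : {nonneg R}) :
  (forall i, measurable_fun setT (Y i)) ->
  (forall A : 'I_n -> set R, (forall i, measurable (A i)) ->
     Q (\bigcap_i (Y i @^-1` A i)) = (c%:num%:E * \prod_(i < n) unit_law R (A i))%E) ->
  forall B : set (n.-tuple R), measurable B ->
  Q ((fun w => [tuple Y i w | i < n]) @^-1` B) = (c%:num%:E * cube_law R n B)%E.
Proof.
elim: n Q Y c => [|n IH] Q Y c mY HQ B mB.
  have := HQ (fun=> setT) (fun=> measurableT).
  rewrite big_ord0 mule1 (_ : \bigcap_i _ = setT); last first.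
    by apply/seteqP; split => w.
  rewrite preimage_tuple0 /= diracE => Qc; case: asboolP => HB.
    by rewrite mem_set // mule1.
  by rewrite measure0 memNset // mule0.
pose Y' (i : 'I_n) := Y (lift ord0 i).
have mY' i : measurable_fun setT (Y' i) by exact: mY.
pose Z w : mR * n.-tuple R := (Y ord0 w, [tuple Y' i w | i < n]).
have mZ : measurable_fun setT Z.
  by apply/measurable_fun_pairP; split; [exact: (mY ord0)|exact: measurable_tuple_of].
have YZ w : [tuple Y i w | i < n.+1] = Defs.cons_tuple (Z w).
  apply: eq_from_tnth => i; rewrite tnth_mktuple.
  case: (unliftP ord0 i) => [j|] ->; last by rewrite /Defs.cons_tuple tnth0.
  by rewrite /Defs.cons_tuple tnthS tnth_mktuple.
have ZE (A1 : set mR) (A2 : set (n.-tuple R)) : measurable A1 -> measurable A2 ->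
    pushforward Q Z (A1 `*` A2) = (c%:num%:E * (unit_law R A1 * cube_law R n A2))%E.
  move=> mA1 mA2.
  have mD : measurable (Y ord0 @^-1` A1) by rewrite -[X in measurable X]setTI; apply: mY.
  have c0 : 0 <= c%:num * fine (unit_law R A1) by rewrite mulr_ge0 // fine_ge0.
  have := IH (mrestr Q mD) Y' (NngNum c0) mY' _ A2 mA2.
  rewrite /pushforward /mrestr /= => H.
  rewrite (_ : Z @^-1` _ = (fun w => [tuple Y' i w | i < n]) @^-1` A2 `&` Y ord0 @^-1` A1);
    last first.
    by apply/seteqP; split => w [].
  rewrite -[LHS]/(mrestr Q mD ((fun w => [tuple Y' i w | i < n]) @^-1` A2)) H.
    by rewrite EFinM fineK ?muleA // fin_num_measure.
  move=> A mA.
  pose A' i := if unlift ord0 i is Some j then A j else A1.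
  have mA' i : measurable (A' i) by rewrite /A'; case: (unlift ord0 i).
  have pA' : (\prod_(i < n.+1) unit_law R (A' i) = unit_law R A1 *
    \prod_(i < n) unit_law R (A i))%E.
    rewrite big_ord_recl /A' unlift_none; congr (_ * _)%E.
    by apply: eq_bigr => i _; rewrite liftK.
  rewrite EFinM fineK ?fin_num_measure // -muleA -pA' -HQ //.
  congr (Q _); apply/seteqP; split => w /=.
    move=> [HA HA1] i _; case: (unliftP ord0 i) => [j|] ->; last by rewrite /A' unlift_none.
    by rewrite /A' liftK; apply: HA.
  move=> HA; split => [j _|]; last by have := HA ord0 I; rewrite /A' unlift_none.
  by have := HA (lift ord0 j) I; rewrite /A' liftK.
(* Uniqueness of product measures is applied to Q divided by c; if c is 0 then
   Q is the zero measure. *)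
have key X : measurable X -> pushforward Q Z X =
  (c%:num%:E * (unit_law R \x cube_law R n)%E X)%E.
  move=> mX; have [c0|c0] := eqVneq c%:num 0.
    have QT : Q setT = 0%E.
      rewrite (_ : setT = \bigcap_(i : 'I_n.+1) (Y i @^-1` setT)).
        by rewrite HQ // c0 mul0e.
      by apply/seteqP; split => w.
    rewrite c0 mul0e /pushforward; apply/eqP; rewrite -measure_le0 -QT.
    apply: le_measure; rewrite ?inE //.
    by rewrite -[X in measurable X]setTI; apply: mZ.
  have c1 : 0 <= c%:num^-1 by rewrite invr_ge0.
  pose pm := measure_function_pushforward__canonical__measure_function_Measure Q mZ.
  have H := @product_measure_unique _ _ _ _ R (unit_law R) (cube_law R n)
    (mscale (NngNum c1) pm).
  rewrite (H _ X mX); last first.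
    move=> A1 A2 mA1 mA2.
    transitivity ((c%:num^-1)%:E * pushforward Q Z (A1 `*` A2))%E; first by [].
    by rewrite ZE // muleA -EFinM mulVf // mul1e.
  transitivity (c%:num%:E * ((c%:num^-1)%:E * pushforward Q Z X))%E; last by [].
  by rewrite muleA -EFinM mulfV // mul1e.
rewrite (_ : _ @^-1` B = Z @^-1` (@Defs.cons_tuple R n @^-1` B)); last first.
  by apply/seteqP; split => w /=; rewrite YZ.
apply: (key (@Defs.cons_tuple R n @^-1` B)).
by rewrite -[X in measurable X]setTI; apply: measurable_cons_tuple.
Qed.

End TupleLaw.

(** * Integration of bounded measurable functions *)

Section BoundedMeasurable.
Local Open Scope classical_set_scope.
Context d (T : measurableType d) (R : realType).
Implicit Types f g : T -> R.

Definition bdd_measurable f := measurable_fun setT f /\ exists C : R, forall x, `|f x| <= C.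

Lemma bdd_measurable_cst (c : R) : bdd_measurable (fun=> c).
Proof. by split=> //; exists `|c|. Qed.

Lemma eq_bmeas f g : f =1 g -> bdd_measurable f -> bdd_measurable g.
Proof. by move=> /funext ->. Qed.

Lemma bdd_measurableD f g : bdd_measurable f -> bdd_measurable g ->
  bdd_measurable (fun x => f x + g x).
Proof.
move=> [mf [C fC]] [mg [D gD]]; split; first exact: measurable_funD.
by exists (C + D) => x; rewrite (le_trans (ler_normD _ _)) // lerD.
Qed.

Lemma bdd_measurableM f g : bdd_measurable f -> bdd_measurable g ->
  bdd_measurable (fun x => f x * g x).
Proof.
move=> [mf [C fC]] [mg [D gD]]; split; first exact: measurable_funM.
by exists (C * D) => x; rewrite normrM ler_pM.
Qed.

Lemma bdd_measurableZ c f : bdd_measurable f -> bdd_measurable (fun x => c * f x).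
Proof. by apply: bdd_measurableM; apply: bdd_measurable_cst. Qed.

Lemma bdd_measurableB f g : bdd_measurable f -> bdd_measurable g ->
  bdd_measurable (fun x => f x - g x).
Proof.
move=> bf bg; apply: eq_bmeas (bdd_measurableD bf (bdd_measurableZ (-1) bg)) => x.
by rewrite mulN1r.
Qed.

Lemma bdd_measurable_sum (I : Type) (r : seq I) (P : pred I) (F : I -> T -> R) :
  (forall i, P i -> bdd_measurable (F i)) ->
    bdd_measurable (fun x => \sum_(i <- r | P i) F i x).
Proof.
move=> bF; elim: r => [|i r IH].
  by apply: (@eq_bmeas (fun=> 0)) (bdd_measurable_cst 0) => x; rewrite big_nil.
apply: (@eq_bmeas (fun x => (if P i then F i x else 0) + \sum_(j <- r | P j) F j x)).
  by move=> x; rewrite big_cons; case: ifP; rewrite ?add0r.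
by apply: bdd_measurableD => //; case Pi: (P i); [apply: bF|apply: bdd_measurable_cst].
Qed.

Lemma bdd_measurable_prod (I : Type) (r : seq I) (P : pred I) (F : I -> T -> R) :
  (forall i, P i -> bdd_measurable (F i)) ->
    bdd_measurable (fun x => \prod_(i <- r | P i) F i x).
Proof.
move=> bF; elim: r => [|i r IH].
  by apply: (@eq_bmeas (fun=> 1)) (bdd_measurable_cst 1) => x; rewrite big_nil.
apply: (@eq_bmeas (fun x => (if P i then F i x else 1) * \prod_(j <- r | P j) F j x)).
  by move=> x; rewrite big_cons; case: ifP; rewrite ?mul1r.
by apply: bdd_measurableM => //; case Pi: (P i); [apply: bF|apply: bdd_measurable_cst].
Qed.

Variable P : probability T R.

Lemma bdd_measurable_integrable f : bdd_measurable f -> P.-integrable setT (EFin \o f).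
Proof.
move=> [mf [C fC]]; apply: measurable_bounded_integrable => //.
  by rewrite (le_lt_trans (probability_le1 _ _)) // ltry.
by exists C; split; rewrite ?num_real // => M CM x _; apply: le_trans (ltW CM).
Qed.

Lemma meanD f g : bdd_measurable f -> bdd_measurable g ->
  \int[P]_x (f x + g x) = \int[P]_x f x + \int[P]_x g x.
Proof. by move=> bf bg; rewrite RintegralD //; apply: bdd_measurable_integrable. Qed.

Lemma meanB f g : bdd_measurable f -> bdd_measurable g ->
  \int[P]_x (f x - g x) = \int[P]_x f x - \int[P]_x g x.
Proof. by move=> bf bg; rewrite RintegralB //; apply: bdd_measurable_integrable. Qed.

Lemma meanZ c f : bdd_measurable f -> \int[P]_x (c * f x) = c * \int[P]_x f x.
Proof. by move=> bf; rewrite RintegralZl //; apply: bdd_measurable_integrable. Qed.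

Lemma mean_cst c : \int[P]_x c = c.
Proof.
rewrite Rintegral_cst // (_ : fine _ = 1) ?mulr1 //.
by rewrite -[RHS]/(fine 1%E); congr fine; apply: probability_setT.
Qed.

Lemma mean_sum (I : Type) (r : seq I) (Q : pred I) (F : I -> T -> R) :
  (forall i, Q i -> bdd_measurable (F i)) ->
  \int[P]_x (\sum_(i <- r | Q i) F i x) = \sum_(i <- r | Q i) \int[P]_x F i x.
Proof.
move=> bF; elim: r => [|i r IH].
  by rewrite big_nil -[RHS]mean_cst; apply: eq_Rintegral => x _; rewrite big_nil.
rewrite big_cons -IH; case: ifPn => Qi; last first.
  by apply: eq_Rintegral => x _; rewrite big_cons (negbTE Qi).
rewrite -meanD; [|exact: bF|exact: bdd_measurable_sum].
by apply: eq_Rintegral => x _; rewrite big_cons Qi.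
Qed.

Lemma le_mean f g : bdd_measurable f -> bdd_measurable g -> (forall x, f x <= g x) ->
  \int[P]_x f x <= \int[P]_x g x.
Proof. by move=> bf bg fg; apply: le_Rintegral => //; apply: bdd_measurable_integrable. Qed.

Lemma mean_norm_le f (c : R) : bdd_measurable f -> (forall x, `|f x| <= c) ->
  `|\int[P]_x f x| <= c.
Proof.
move=> bf fc; rewrite ler_norml -{1}(mean_cst (- c)) -{2}(mean_cst c).
have bc := @bdd_measurable_cst; apply/andP; split; apply: le_mean => // x.
  by have := fc x; rewrite ler_norml => /andP[].
by have := fc x; rewrite ler_norml => /andP[].
Qed.

End BoundedMeasurable.

Lemma bdd_measurable_comp d d' (T : measurableType d) (T' : measurableType d')
    (R : realType) (h : T' -> T) (f : T -> R) :
  measurable_fun [set: T']%classic h -> bdd_measurable f -> bdd_measurable (f \o h).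
Proof.
move=> mh [mf [C fC]]; split; first exact: measurableT_comp.
by exists C => x; apply: fC.
Qed.

(** The integral of (h - l z)^2 is nonnegative for every l, hence its linear
    coefficient in l vanishes when its constant term does. *)
Lemma mean_sqr0_orthogonal d (T : measurableType d) (R : realType)
    (P : probability T R) (h z : T -> R) :
  bdd_measurable h -> bdd_measurable z -> \int[P]_x (h x * h x) = 0 -> \int[P]_x (h x * z x) =
    0.
Proof.
move=> bh bz h0.
set c := \int[P]_x (h x * z x); set m := \int[P]_x (z x * z x).
have m0 : 0 <= m by apply: Rintegral_ge0 => x _; rewrite -expr2 sqr_ge0.
have key l : 0 <= l ^+ 2 * m - 2 * l * c.
  have -> : l ^+ 2 * m - 2 * l * c = \int[P]_x ((h x - l * z x) * (h x - l * z x)).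
    transitivity (\int[P]_x (h x * h x + (l ^+ 2 * (z x * z x) - (2 * l) * (h x * z x)))).
      rewrite meanD; [|exact: bdd_measurableM|apply: bdd_measurableB; apply: bdd_measurableZ;
        exact: bdd_measurableM].
      rewrite meanB; [|by apply: bdd_measurableZ; apply: bdd_measurableM..].
      by rewrite !meanZ ?h0 ?add0r //; apply: bdd_measurableM.
    by apply: eq_Rintegral => x _; ring.
  by apply: Rintegral_ge0 => x _; rewrite -expr2 sqr_ge0.
apply/eqP; apply: contraT => c0.
have m1 : 0 < m + 1 by lra.
have := key (c / (m + 1)).
have -> : (c / (m + 1)) ^+ 2 * m - 2 * (c / (m + 1)) * c =
    - (c ^+ 2 / (m + 1) ^+ 2) * (m + 2) by field; lra.
rewrite mulNr oppr_ge0 leNgt => /negP[]; rewrite mulr_gt0 ?divr_gt0 ?exprn_even_gt0 //;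
  last lra.
by rewrite /= gt_eqF.
Qed.

Section ImageLaw.
Local Open Scope classical_set_scope.
Context d d' (T : measurableType d) (T' : measurableType d') (R : realType).

Lemma mean_image (P : probability T R) (P' : probability T' R) (h : T -> T') (f : T' -> R) :
  measurable_fun setT h ->
  (forall B, measurable B -> P (h @^-1` B) = P' B) -> bdd_measurable f ->
  \int[P]_x f (h x) = \int[P']_y f y.
Proof.
move=> mh PP' bf; rewrite /Rintegral; congr fine.
have bfh := bdd_measurable_comp mh bf.
transitivity (\int[pushforward P h]_(y in setT) (EFin \o f) y)%E.
  rewrite integral_pushforward //; first by apply/measurable_EFinP; case: bf.
  by rewrite preimage_setT; apply: (bdd_measurable_integrable P bfh).
apply: (@eq_measure_integral _ _ _ _ P'
  (measure_function_pushforward__canonical__measure_function_Measure P mh)).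
by move=> A mA _; apply: PP'.
Qed.

Lemma mean_prod (P : probability T R) (P' : probability T' R) (f : T * T' -> R) :
  bdd_measurable f ->
  bdd_measurable (fun y => \int[P]_x f (x, y)) /\
  \int[(P \x P')%E]_z f z = \int[P']_y \int[P]_x f (x, y).
Proof.
move=> bf; have [mf [C fC]] := bf.
have bf1 y : bdd_measurable (fun x => f (x, y)).
  by split; [apply: (measurableT_comp mf); apply: pair2_measurable|exists C].
have fint : ((P \x P')%E).-integrable setT (EFin \o f).
  by apply: bdd_measurable_integrable.
have FE y : (\int[P]_x f (x, y))%:E = (\int[P]_x (f (x, y))%:E)%E.
  by rewrite fineK //; apply: integrable_fin_num => //; apply:
    (bdd_measurable_integrable P (bf1 y)).
split.
  split; last by exists C => y; apply: mean_norm_le.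
  apply/measurable_EFinP; rewrite (_ : _ \o _ = fubini_G P (EFin \o f)).
    apply: (measurable_fubini_G (m2 := P')) => //.
  by apply/funext => y /=; rewrite FE.
rewrite {1}/Rintegral -(integral21_prod_meas1 fint) /=.
by congr fine; apply: eq_integral => y _; rewrite FE.
Qed.

End ImageLaw.

(** * Integrating out coordinates of the cube *)

Section IidUniform.
Local Open Scope classical_set_scope.

Variable R : realType.

(** Independence and uniform laws at once, through the product formula over all
    indices; subfamilies are obtained by taking the whole line as the other
    sets. *)
Definition iid_uniform d (T : measurableType d) (P : probability T R) (I : finType)
    (Y : I -> T -> R) :=
  (forall i, measurable_fun setT (Y i)) /\
  (forall A : I -> set R, (forall i, measurable (A i)) ->
    P (\bigcap_i (Y i @^-1` A i)) = (\prod_i unit_law R (A i))%E).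

Lemma unit_lawT : unit_law R setT = 1%E.
Proof. exact: probability_setT. Qed.

Lemma iid_uniform_inj d (T : measurableType d) (P : probability T R) (I J : finType)
    (Y : I -> T -> R) (rho : J -> I) :
  injective rho -> iid_uniform P Y -> iid_uniform P (fun j => Y (rho j)).
Proof.
move=> inj [mY PY]; split=> [j|A mA]; first exact: mY.
pose A' i := if [pick j | rho j == i] is Some j then A j else setT.
have mA' i : measurable (A' i) by rewrite /A'; case: pickP.
have A'rho j : A' (rho j) = A j.
  by rewrite /A'; case: pickP => [j' /eqP/inj ->//|/(_ j)]; rewrite eqxx.
transitivity (P (\bigcap_i (Y i @^-1` A' i))).
  congr (P _); apply/seteqP; split => w H i _ /=.
    rewrite /A'; case: pickP => [j /eqP <-|//]; exact: H.
  by have := H (rho i) Logic.I; rewrite /= A'rho.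
rewrite PY // (bigID (fun i => i \in codom rho)) /= [X in (_ * X)%E]big1 ?mule1; last first.
  move=> i ni; rewrite /A'; case: pickP => [j /eqP e|_]; last exact: unit_lawT.
  by rewrite -e codom_f in ni.
rewrite -big_uniq /=; last by rewrite map_inj_uniq // enum_uniq.
by rewrite /codom big_map big_enum /=; apply: eq_bigr => j _; rewrite A'rho.
Qed.

Lemma mean_iid d (T : measurableType d) (P : probability T R) n (Y : 'I_n -> T -> R)
    (f : n.-tuple R -> R) :
  iid_uniform P Y -> bdd_measurable f ->
  \int[P]_w f [tuple Y i w | i < n] = \int[cube_law R n]_x f x.
Proof.
move=> [mY PY] bf; apply: (mean_image (h := fun w => [tuple Y i w | i < n])) => //.
  exact: measurable_tuple_of.
move=> B mB; rewrite (tuple_law (c := 1%:nng)) ?mul1e //.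
by move=> A mA; rewrite mul1e; apply: PY.
Qed.

Lemma cube_iid n : iid_uniform (cube_law R n) (fun i x => tnth x i).
Proof.
split=> [i|]; first exact: measurable_tnth.
elim: n => [|n IH] A mA.
  rewrite big_ord0 (_ : \bigcap_i _ = setT); first exact: probability_setT.
  by apply/seteqP; split => w // _ [].
rewrite big_ord_recl -IH; last by move=> i; apply: mA.
rewrite -product_measure1E; [|exact: mA|]; last first.
  apply: fin_bigcap_measurable => // i _.
  by rewrite -[X in measurable X]setTI; apply: measurable_tnth.
transitivity ((unit_law R \x cube_law R n)%E (@Defs.cons_tuple R n @^-1`
    \bigcap_i ((fun x : n.+1.-tuple R => tnth x i) @^-1` A i))); first by [].
congr ((unit_law R \x cube_law R n)%E _); apply/seteqP; split => [[u x]|[u x]] /=.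
  move=> H; split; first by have := H ord0 I; rewrite /Defs.cons_tuple /= tnth0.
  by move=> i _; have := H (lift ord0 i) I; rewrite /Defs.cons_tuple /= tnthS.
move=> [Hu Hx] i _ /=; rewrite /Defs.cons_tuple /=.
case: (unliftP ord0 i) => [j|] ->; last by rewrite tnth0.
by rewrite tnthS; apply: Hx.
Qed.

(** Marginals and permutations of the uniform law on a cube are uniform laws on
    cubes. *)
Lemma mean_relabel n k (rho : 'I_k -> 'I_n) (f : k.-tuple R -> R) :
  injective rho -> bdd_measurable f ->
  \int[cube_law R n]_x f [tuple tnth x (rho i) | i < k] = \int[cube_law R k]_x f x.
Proof.
by move=> inj bf; apply: mean_iid => //; apply: iid_uniform_inj inj (cube_iid n).
Qed.

End IidUniform.

Section IntegrateCoordinate.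
Import mathcomp.boot.fintype mathcomp.boot.finset.
Variables (R : realType).

Definition set_coord n (i : 'I_n) (u : R) (x : n.-tuple R) : n.-tuple R :=
  [tuple if j == i then u else tnth x j | j < n].

Definition tuple_depends_on n (D : {set 'I_n}) (f : n.-tuple R -> R) :=
  forall x y, (forall j, j \in D -> tnth x j = tnth y j) -> f x = f y.

(** The conditional mean of f given all coordinates but the i-th, kept as a
    function on the same cube so that it can be iterated in any order. *)
Definition integrate_coord n (i : 'I_n) (f : n.-tuple R -> R) (x : n.-tuple R) : R :=
  \int[unit_law R]_u f (set_coord i u x).

Lemma tuple_depends_on_sub n (D D' : {set 'I_n}) (f : n.-tuple R -> R) : D \subset D' ->
  tuple_depends_on D f -> tuple_depends_on D' f.
Proof. by move=> /subsetP DD' hD x y e; apply: hD => j /DD'; apply: e. Qed.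

Lemma measurable_set_coord n (i : 'I_n) :
  measurable_fun [set: _]%classic (fun p : measurableTypeR R * n.-tuple R =>
    set_coord i p.1 p.2).
Proof.
apply: measurable_tuple_of => j; case: eqP => _.
  exact: (@measurable_fst _ _ (measurableTypeR R) (n.-tuple R)).
apply: (measurableT_comp (measurable_tnth j)).
exact: (@measurable_snd _ _ (measurableTypeR R) (n.-tuple R)).
Qed.

Lemma bdd_measurable_set_coord n (i : 'I_n) (f : n.-tuple R -> R) : bdd_measurable f ->
  bdd_measurable (fun p : measurableTypeR R * n.-tuple R => f (set_coord i p.1 p.2)).
Proof. by move=> bf; apply: (bdd_measurable_comp (measurable_set_coord i) bf). Qed.

Lemma bdd_measurable_set_coord1 n (i : 'I_n) (f : n.-tuple R -> R) x : bdd_measurable f ->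
  bdd_measurable (fun u : measurableTypeR R => f (set_coord i u x)).
Proof.
move=> /(bdd_measurable_set_coord i) bf.
by apply: (bdd_measurable_comp (h := fun u => (u, x)) _ bf); apply: pair2_measurable.
Qed.

Lemma bdd_measurable_integrate_coord n (i : 'I_n) (f : n.-tuple R -> R) : bdd_measurable f ->
  bdd_measurable (integrate_coord i f).
Proof.
by move=> bf; have [] := mean_prod (unit_law R) (cube_law R n) (bdd_measurable_set_coord i bf).
Qed.

(** Replacing the i-th coordinate of a uniform point by an independent uniform
    variable keeps its law uniform. *)
Lemma mean_integrate_coord n (i : 'I_n) (f : n.-tuple R -> R) : bdd_measurable f ->
  \int[cube_law R n]_x integrate_coord i f x = \int[cube_law R n]_x f x.
Proof.
move=> bf; have [_ <-] := mean_prod (unit_law R) (cube_law R n) (bdd_measurable_set_coord i bf).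
apply: (mean_iid (P := (unit_law R \x cube_law R n)%E)
  (Y := fun j p => if j == i then p.1 else tnth p.2 j)) => //.
split=> [j|A mA].
  case: eqP => _; first exact: (@measurable_fst _ _ (measurableTypeR R) (n.-tuple R)).
  apply: (measurableT_comp (measurable_tnth j)).
  exact: (@measurable_snd _ _ (measurableTypeR R) (n.-tuple R)).
pose A' j := if j == i then [set: R]%classic else A j.
have mA' j : measurable (A' j) by rewrite /A'; case: eqP.
transitivity ((unit_law R \x cube_law R n)%E
    (A i `*` \bigcap_j ((fun x : n.-tuple R => tnth x j) @^-1` A' j)))%classic.
  congr ((unit_law R \x cube_law R n)%E _); apply/classical_sets.seteqP; split =>
    [[u x]|[u x]] /= H.
    split; first by have := H i Logic.I; rewrite /= eqxx.
    by move=> j _ /=; rewrite /A'; have := H j Logic.I; rewrite /=; case: eqP.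
  move=> j _ /=; have [Hu Hx] := H; have := Hx j Logic.I; rewrite /= /A'.
  by case: eqP => [->|].
rewrite product_measure1E; [|exact: mA|]; last first.
  apply: fin_bigcap_measurable => // j _.
  by rewrite -[X in measurable X]classical_sets.setTI; apply: measurable_tnth.
have [_ cubeA'] := cube_iid R n.
transitivity (unit_law R (A i) * \prod_j unit_law R (A' j))%E.
  by congr (_ * _)%E; apply: cubeA'.
rewrite (bigD1 i) //= [RHS](bigD1 i) //= {1}/A' eqxx unit_lawT mul1e; congr (_ * _)%E.
by apply: eq_bigr => j /negbTE ji; rewrite /A' ji.
Qed.

Lemma tuple_depends_on_integrate_coord n (D : {set 'I_n}) i (f : n.-tuple R -> R) :
  tuple_depends_on D f -> tuple_depends_on (D :\ i) (integrate_coord i f).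
Proof.
move=> fD x y e; apply: eq_Rintegral => u _; apply: fD => j jD.
by rewrite !tnth_mktuple; case: eqP => // /eqP ji; apply: e; rewrite !inE ji.
Qed.

(** A factor that does not read coordinate i comes out of the integral. *)
Lemma integrate_coordM n i (h f : n.-tuple R -> R) x : tuple_depends_on [set~ i] h ->
  bdd_measurable f ->
  integrate_coord i (fun y => h y * f y) x = h x * integrate_coord i f x.
Proof.
move=> hi bf; rewrite /integrate_coord -meanZ; last exact: bdd_measurable_set_coord1.
apply: eq_Rintegral => u _; congr (_ * _); apply: hi => j; rewrite !inE => /negbTE ji.
by rewrite tnth_mktuple ji.
Qed.

Definition integrate_coords n (s : seq 'I_n) f := foldr (@integrate_coord n) f s.

Lemma bdd_measurable_integrate_coords n (s : seq 'I_n) (f : n.-tuple R -> R) :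
  bdd_measurable f -> bdd_measurable (integrate_coords s f).
Proof. by move=> bf; elim: s => //= i s IH; apply: bdd_measurable_integrate_coord. Qed.

Lemma mean_integrate_coords n (s : seq 'I_n) (f : n.-tuple R -> R) : bdd_measurable f ->
  \int[cube_law R n]_x integrate_coords s f x = \int[cube_law R n]_x f x.
Proof.
move=> bf; elim: s => //= i s <-; exact/mean_integrate_coord/bdd_measurable_integrate_coords.
Qed.

Lemma tuple_depends_on_integrate_coords n (D : {set 'I_n}) s (f : n.-tuple R -> R) :
  tuple_depends_on D f -> tuple_depends_on (D :\: [set i in s]) (integrate_coords s f).
Proof.
move=> fD; elim: s => [|i s IH] /=.
  by apply: tuple_depends_on_sub fD; apply/subsetP => j; rewrite !inE.
apply: (tuple_depends_on_sub _ (tuple_depends_on_integrate_coord (i := i) IH));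
  apply/subsetP => j; rewrite !inE negb_or.
by case/andP => -> /andP[-> ->].
Qed.

Lemma integrate_coordsM n s (h f : n.-tuple R -> R) : tuple_depends_on (~: [set i in s]) h ->
  bdd_measurable f ->
  integrate_coords s (fun y => h y * f y) =1 (fun x => h x * integrate_coords s f x).
Proof.
move=> hs bf; elim: s hs => //= i s IH hs x.
rewrite -integrate_coordM; last exact: bdd_measurable_integrate_coords.
  by rewrite (_ : integrate_coords s _ = fun x => h x * integrate_coords s f x) //;
    apply/funext => y; apply: IH;
    apply: tuple_depends_on_sub hs; apply/subsetP => j; rewrite !inE negb_or => /andP[].
by apply: tuple_depends_on_sub hs; apply/subsetP => j; rewrite !inE negb_or => /andP[].
Qed.

(** Integrating out D makes f constant and leaves g untouched. *)
Lemma mean_indep n (D : {set 'I_n}) (f g : n.-tuple R -> R) : bdd_measurable f ->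
  bdd_measurable g ->
  tuple_depends_on D f -> tuple_depends_on (~: D) g ->
  \int[cube_law R n]_x (f x * g x) =
  \int[cube_law R n]_x f x * \int[cube_law R n]_x g x.
Proof.
move=> bf bg fD gD.
have enumD : [set i in enum D] = D by apply/setP => i; rewrite inE mem_enum.
have fc x : integrate_coords (enum D) f x = \int[cube_law R n]_x f x.
  rewrite -(mean_integrate_coords (enum D) bf) -[LHS](mean_cst (cube_law R n)).
  apply: eq_Rintegral => y _; apply: (tuple_depends_on_integrate_coords (s := enum D) fD) => j.
  by rewrite enumD setDv inE.
rewrite -meanZ // -(mean_integrate_coords (enum D)); last exact: bdd_measurableM.
rewrite (_ : (fun x => f x * g x) = fun x => g x * f x); last by apply/funext => x;
  rewrite mulrC.
by apply: eq_Rintegral => x _; rewrite integrate_coordsM ?enumD // fc mulrC.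
Qed.

Definition relabel n k (rho : 'I_k -> 'I_n) (x : n.-tuple R) : k.-tuple R :=
  [tuple tnth x (rho i) | i < k].

Lemma bdd_measurable_relabel n k (rho : 'I_k -> 'I_n) (f : k.-tuple R -> R) :
  bdd_measurable f -> bdd_measurable (f \o relabel rho).
Proof.
move=> bf; apply: (bdd_measurable_comp _ bf); apply: measurable_tuple_of => i.
exact: measurable_tnth.
Qed.

Lemma relabel_set_coord n k (rho : 'I_k -> 'I_n) i u x : injective rho ->
  relabel rho (set_coord (rho i) u x) = set_coord i u (relabel rho x).
Proof.
by move=> inj; apply: eq_from_tnth => j; rewrite !tnth_mktuple inj_eq.
Qed.

Lemma integrate_coords_relabel n k (rho : 'I_k -> 'I_n) s (f : k.-tuple R -> R) x :
  injective rho ->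
  integrate_coords (map rho s) (f \o relabel rho) x = integrate_coords s f (relabel rho x).
Proof.
move=> inj; elim: s x => //= i s IH x; apply: eq_Rintegral => u _.
by rewrite IH relabel_set_coord.
Qed.

(** The conditional mean of f given that the a-th coordinate equals u: once all
    other coordinates are integrated out, any point with a-th coordinate u may
    be used. *)
Definition cond_mean k (a : 'I_k) (f : k.-tuple R -> R) (u : R) : R :=
  integrate_coords (enum [set~ a]) f [tuple u | _ < k].

Lemma bdd_measurable_cond_mean k (a : 'I_k) (f : k.-tuple R -> R) : bdd_measurable f ->
  bdd_measurable (cond_mean a f : measurableTypeR R -> R).
Proof.
move=> bf; apply: (bdd_measurable_comp (h := fun u : measurableTypeR R => [tuple u | _ < k])
  _ (bdd_measurable_integrate_coords (enum [set~ a]) bf)).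
by apply: measurable_tuple_of => i; apply: measurable_id.
Qed.

(** The coordinates placed by rho, except that of a, are not read by g and can
    be integrated out of f. *)
Lemma mean_attach n k (rho : 'I_k -> 'I_n) a (D : {set 'I_n}) (f : k.-tuple R -> R)
  (g : n.-tuple R -> R) :
  injective rho -> (forall j, rho j \in D -> j = a) ->
  bdd_measurable f -> bdd_measurable g -> tuple_depends_on D g ->
  \int[cube_law R n]_x (f (relabel rho x) * g x) =
  \int[cube_law R n]_x (cond_mean a f (tnth x (rho a)) * g x).
Proof.
move=> inj Da bf bg gD; set s := map rho (enum [set~ a]).
have bfr := bdd_measurable_relabel rho bf.
rewrite -(mean_integrate_coords s); last exact: bdd_measurableM.
rewrite (_ : (fun x => f (relabel rho x) * g x) =
    fun x => g x * (f \o relabel rho) x); last by apply/funext => x; rewrite mulrC.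
apply: eq_Rintegral => x _; rewrite integrate_coordsM //; last first.
  apply: tuple_depends_on_sub gD; apply/subsetP => j jD; rewrite !inE.
  apply/mapP => -[i]; rewrite mem_enum !inE => /eqP ia e; apply: ia; apply: Da.
  by rewrite -e.
rewrite mulrC integrate_coords_relabel //; congr (_ * _).
have fT : tuple_depends_on [set: 'I_k] f by move=> y z e; congr f; apply: eq_from_tnth => j;
  apply: e.
apply: (tuple_depends_on_integrate_coords (s := enum [set~ a]) fT) => j;
  rewrite !inE mem_enum !inE andbT negbK => /eqP ->.
by rewrite !tnth_mktuple.
Qed.

End IntegrateCoordinate.

(** * Homomorphism densities and singularity *)

Section EdgeProduct.
Import mathcomp.boot.fintype mathcomp.boot.finset.
Variable (R : realType) (g : R * R -> R).
Hypothesis g_graph : graph_function g.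

Definition in_unit (u : R) : bool := 0 <= u <= 1.

Lemma in_unitP u : in_unit u <-> @unit_itv R u.
Proof. by rewrite /in_unit /unit_itv /= in_itv. Qed.

(** A graph function is arbitrary outside the unit square; setting it to 0
    there makes it measurable on the plane. *)
Definition gbar (p : R * R) : R :=
  if in_unit p.1 && in_unit p.2 then g p else 0.

Lemma gbar_sym x y : gbar (x, y) = gbar (y, x).
Proof.
rewrite /gbar /= andbC; case: ifP => // /andP[uy ux].
by have [_ gs _] := g_graph; apply: gs; apply/in_unitP.
Qed.

Lemma gbar01 p : 0 <= gbar p <= 1.
Proof.
case: p => x y; rewrite /gbar /=; case: ifP => [/andP[ux uy]|_]; last by rewrite lexx ler01.
by have [_ _] := g_graph; apply; apply/in_unitP.
Qed.

Lemma gbar_ge0 p : 0 <= gbar p.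
Proof. by case/andP: (gbar01 p). Qed.

Lemma measurable_gbar : measurable_fun [set: R * R]%classic gbar.
Proof.
have [mg _ _] := g_graph.
have mU : measurable (@unit_itv R) by exact: measurable_itv.
have -> : gbar = patch (fun=> 0) (@unit_itv R `*` @unit_itv R)%classic g.
  apply/funext => -[x y]; rewrite /gbar /patch /=; congr (if _ then _ else _).
  apply/idP/idP => [/andP[/in_unitP ux /in_unitP uy]|]; first exact: mem_set.
  by move/set_mem => -[/in_unitP ? /in_unitP ?]; apply/andP.
by apply/(measurable_restrictT _ (measurableX mU mU)).
Qed.

Lemma bdd_measurable_gbar n (i j : 'I_n) :
  bdd_measurable (fun x : n.-tuple R => gbar (tnth x i, tnth x j)).
Proof.
apply: (bdd_measurable_comp (h := fun x : n.-tuple R => (tnth x i, tnth x j)) (f := gbar)).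
  by apply/measurable_fun_pairP; split; apply: measurable_tnth.
split; first exact: measurable_gbar.
by exists 1 => p; have /andP[? ?] := gbar01 p; rewrite ger0_norm.
Qed.

Section Vertices.
Variables (V : finType) (F : sgraph V).

(** The ranking r chooses an orientation of each edge; by [edge_prodE] the
    result is the same for every injective r. *)
Definition edge_prod (r : V -> nat) (x : V -> R) : R :=
  \prod_(e : V * V | F e.1 e.2 && (r e.1 < r e.2)%N) gbar (x e.1, x e.2).

Definition arc_prod (x : V -> R) : R :=
  \prod_(e : V * V | F e.1 e.2) gbar (x e.1, x e.2).

Lemma edge_prod_ge0 r x : 0 <= edge_prod r x.
Proof. by apply: prodr_ge0 => e _; apply: gbar_ge0. Qed.

(** Every edge carries two arcs with the same factor, so the product over arcs
    is the square of the product over edges. *)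
Lemma edge_prodE r x : injective r -> edge_prod r x = Num.sqrt (arc_prod x).
Proof.
move=> inj; rewrite -[LHS]ger0_norm ?edge_prod_ge0 // -sqrtr_sqr; congr Num.sqrt.
rewrite expr2 /arc_prod (bigID (fun e : V * V => (r e.1 < r e.2)%N)) /=; congr (_ * _).
rewrite /edge_prod (reindex_inj (h := fun e : V * V => (e.2, e.1))) /=; last first.
  by move=> [a b] [c d] [-> ->].
apply: eq_big => [[a b]|[a b] _] /=; last exact: gbar_sym.
rewrite adj_sym -leqNgt; case Fab: (F a b) => //=.
rewrite [RHS]leq_eqVlt; case: eqP => [/inj ab|//].
by rewrite ab adj_irr in Fab.
Qed.

End Vertices.

Definition hom_prod k (F : sgraph 'I_k) (x : k.-tuple R) : R :=
  edge_prod F (@nat_of_ord k) (tnth x).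

Lemma bdd_measurable_edge_prod (V : finType) (F : sgraph V) r n (rho : V -> 'I_n) :
  bdd_measurable (fun x : n.-tuple R => edge_prod F r (fun v => tnth x (rho v))).
Proof. by apply: bdd_measurable_prod => e _; apply: bdd_measurable_gbar. Qed.

Lemma edge_prod01 (V : finType) (F : sgraph V) r x : 0 <= edge_prod F r x <= 1.
Proof.
rewrite edge_prod_ge0 /=; apply: prodr_ile1 => e _; exact: gbar01.
Qed.

Definition cube_density k (F : sgraph 'I_k) : R := \int[cube_law R k]_x hom_prod F x.

(** The points outside the unit cube form a null set, and inside it g and gbar
    agree. *)
Lemma hom_densityE (V : finType) (F : sgraph V) :
  hom_density F g =
  \int[cube_law R #|V|]_x edge_prod F (fun v => enum_rank v) (fun v => tnth x (enum_rank v)).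
Proof.
set D := [set x : #|V|.-tuple R | forall i, @unit_itv R (tnth x i)]%classic.
set f := fun x : #|V|.-tuple R => edge_prod F (fun v => enum_rank v)
  (fun v => tnth x (enum_rank v)).
have bf : bdd_measurable f by apply: bdd_measurable_edge_prod.
pose d (x : #|V|.-tuple R) : R := \prod_i (in_unit (tnth x i))%:R.
have dE x : d x = (x \in D)%:R.
  have [xD|xD] := boolP (x \in D).
    rewrite /d big1 // => i _.
    by have -> : in_unit (tnth x i) by apply/in_unitP; exact: (set_mem xD).
  apply/eqP; rewrite /d prodf_seq_eq0; apply/hasP.
  have /existsP[i ni] : [exists i, ~~ in_unit (tnth x i)].
    apply: contraNT xD => /existsPn H; apply: mem_set => i; apply/in_unitP.
    by have := H i; rewrite negbK.
  by exists i; rewrite ?mem_index_enum // (negbTE ni) eqxx.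
have bd : bdd_measurable d.
  apply: bdd_measurable_prod => i _.
  apply: (bdd_measurable_comp (h := fun x : #|V|.-tuple R => tnth x i)
    (f := fun u : R => (in_unit u)%:R)).
    exact: measurable_tnth.
  split; last by exists 1 => u; case: in_unit; rewrite ?normr1 ?normr0 ?ler01.
  rewrite (_ : (fun u => _) = \1_(@unit_itv R)); first by apply: measurable_indic; exact:
    measurable_itv.
  apply/funext => u; rewrite indicE; congr (_%:R); congr nat_of_bool.
  by apply/idP/idP => [/in_unitP uu|/set_mem/in_unitP//]; apply: mem_set.
have dmean : \int[cube_law R #|V|]_x d x = 1.
  have mD : measurable D.
    rewrite (_ : D = \bigcap_i ((fun x : #|V|.-tuple R => tnth x i) @^-1` @unit_itv R))%classic.
      apply: fin_bigcap_measurable => // i _.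
      rewrite -[X in measurable X]classical_sets.setTI.
      by apply: measurable_tnth => //; exact: measurable_itv.
    by apply/classical_sets.seteqP; split => x H i; [move=> _; exact: H|exact: (H i Logic.I)].
  have PD : cube_law R #|V| D = 1%E.
    have [_ H] := cube_iid R #|V|.
    rewrite (_ : D = \bigcap_i ((fun x : #|V|.-tuple R => tnth x i) @^-1` @unit_itv R))%classic.
      rewrite (H (fun=> @unit_itv R)); last by move=> i; exact: measurable_itv.
      rewrite big1 // => i _; exact: integral_uniform_pdf1.
    by apply/classical_sets.seteqP; split => x H' i;
      [move=> _; exact: H'|exact: (H' i Logic.I)].
  rewrite (_ : d = \1_D); last by apply/funext => x; rewrite dE indicE.
  rewrite -[RHS]/(fine 1%E) -PD /Rintegral integral_indic //.
  by rewrite classical_sets.setIT.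
rewrite /hom_density -/D Rintegral_mkcond.
transitivity (\int[cube_law R #|V|]_x (f x * d x)).
  apply: eq_Rintegral => x _; rewrite dE /patch; case: ifPn => xD; last by rewrite mulr0.
  rewrite mulr1; apply: eq_bigr => e _; move/set_mem: xD => xD.
  have xu i : in_unit (tnth x i) by apply/in_unitP; exact: xD.
  by rewrite /gbar /= !xu.
apply/eqP; rewrite eq_sym -subr_eq0 -normr_le0.
rewrite -meanB //; last exact: bdd_measurableM.
have d01 x : 0 <= d x <= 1 by rewrite dE; case: (x \in D); rewrite ?lexx ler01.
have f01 x : 0 <= f x <= 1 by apply: edge_prod01.
rewrite ger0_norm; last first.
  apply: Rintegral_ge0 => x _; have /andP[? ?] := d01 x; have /andP[? ?] := f01 x.
  by rewrite subr_ge0 ler_piMr.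
apply: (le_trans (y := \int[cube_law R #|V|]_x (1 - d x))); last first.
  by rewrite meanB ?mean_cst ?dmean ?subrr //; apply: bdd_measurable_cst.
apply: le_mean; [by apply: bdd_measurableB => //; apply: bdd_measurableM| |].
  by apply: bdd_measurableB => //; apply: bdd_measurable_cst.
move=> x; have /andP[? ?] := d01 x; have /andP[? ?] := f01 x.
by rewrite (_ : f x - _ = f x * (1 - d x)) ?ler_piMl ?subr_ge0 // mulrBr mulr1.
Qed.


Lemma arc_prodE (V : finType) (F : sgraph V) x :
  arc_prod F x = \prod_u \prod_v (if F u v then gbar (x u, x v) else 1).
Proof. by rewrite pair_bigA /= /arc_prod big_mkcond. Qed.

Lemma arc_prod_ge0 (V : finType) (F : sgraph V) x : 0 <= arc_prod F x.
Proof. by apply: prodr_ge0 => e _; apply: gbar_ge0. Qed.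

Lemma arc_prod_disjoint_union (V1 V2 : finType) (F1 : sgraph V1) (F2 : sgraph V2) x :
  arc_prod (disjoint_union F1 F2) x =
  arc_prod F1 (x \o inl) * arc_prod F2 (x \o inr).
Proof.
rewrite !arc_prodE big_sumType /=; congr (_ * _); apply: eq_bigr => u _.
  by rewrite big_sumType /= [X in _ * X]big1 ?mulr1.
by rewrite big_sumType /= big1 ?mul1r.
Qed.

(** The inclusion of the second graph in the merged one, through which the
    edges of the merged graph are those of its two parts. *)
Definition merge_inr (V1 V2 : finType) (i1 : V1) (i2 w : V2) : V1 + {v : V2 | v != i2} :=
  if insub w is Some w' then inr w' else inl i1.

Lemma merge_inr_root (V1 V2 : finType) (i1 : V1) (i2 : V2) : merge_inr i1 i2 i2 = inl i1.
Proof. by rewrite /merge_inr insubF ?eqxx. Qed.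

Lemma merge_inr_val (V1 V2 : finType) (i1 : V1) (i2 : V2) (w : {v : V2 | v != i2}) :
  merge_inr i1 i2 (val w) = inr w.
Proof. by rewrite /merge_inr valK. Qed.

Lemma merge_inr_inj (V1 V2 : finType) (i1 : V1) (i2 : V2) : injective (merge_inr i1 i2).
Proof.
move=> w w'; rewrite /merge_inr; case: insubP => [a _ <-|/negPn/eqP ->];
  case: insubP => [b _ <-|/negPn/eqP ->] //.
by move=> [->].
Qed.

Lemma big_merge (V2 : finType) (i2 : V2) (Phi : V2 -> R) :
  \prod_w Phi w = Phi i2 * \prod_(b : {v : V2 | v != i2}) Phi (val b).
Proof. by rewrite (bigD1 i2) //= (big_sub (fun w => w != i2)). Qed.

Lemma arc_prod_merge (V1 V2 : finType) (F1 : sgraph V1) (F2 : sgraph V2) i1 i2 x :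
  arc_prod (Defs.merge F1 F2 i1 i2) x =
  arc_prod F1 (x \o inl) * arc_prod F2 (x \o merge_inr i1 i2).
Proof.
rewrite !arc_prodE big_sumType /= (big_merge i2) /=.
under eq_bigr do rewrite big_sumType /=.
rewrite big_split /= -mulrA; congr (_ * _); congr (_ * _).
  rewrite exchange_big /= (big_merge i2) /= adj_irr mul1r.
  apply: eq_bigr => b _; rewrite merge_inr_root merge_inr_val.
  rewrite (bigD1 i1) //= eqxx /= [X in _ * X]big1 ?mulr1 // => a /negbTE ai1.
  by rewrite ai1.
apply: eq_bigr => b _; rewrite big_sumType /= (big_merge i2) /=; congr (_ * _).
  rewrite merge_inr_root merge_inr_val.
  rewrite (bigD1 i1) //= eqxx /= [X in _ * X]big1 ?mulr1 // => a /negbTE ai1.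
  by rewrite ai1.
by apply: eq_bigr => b' _; rewrite !merge_inr_val.
Qed.

Lemma hom_prod_relabel k (F : sgraph 'I_k) n (rho : 'I_k -> 'I_n) x :
  hom_prod F (relabel rho x) = Num.sqrt (arc_prod F (fun v => tnth x (rho v))).
Proof.
rewrite /hom_prod edge_prodE; last exact: val_inj.
by congr (Num.sqrt (arc_prod F _)); apply/funext => v; rewrite tnth_mktuple.
Qed.

Lemma bdd_measurable_hom_prod k (F : sgraph 'I_k) : bdd_measurable (hom_prod F).
Proof. exact: (@bdd_measurable_edge_prod _ F _ _ id). Qed.

Lemma enum_rank_nat_inj (V : finType) : injective (fun v : V => nat_of_ord (enum_rank v)).
Proof. by move=> u v /val_inj/enum_rank_inj. Qed.

(** The two components read disjoint groups of coordinates. *)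
Lemma hom_density_union k1 k2 (F1 : sgraph 'I_k1) (F2 : sgraph 'I_k2) :
  hom_density (disjoint_union F1 F2) g = cube_density F1 * cube_density F2.
Proof.
rewrite hom_densityE.
pose rho1 (a : 'I_k1) := enum_rank (inl a : 'I_k1 + 'I_k2)%type.
pose rho2 (a : 'I_k2) := enum_rank (inr a : 'I_k1 + 'I_k2)%type.
have inj1 : injective rho1 by move=> a b /enum_rank_inj[].
have inj2 : injective rho2 by move=> a b /enum_rank_inj[].
rewrite /cube_density -(mean_relabel inj1 (bdd_measurable_hom_prod F1))
  -(mean_relabel inj2 (bdd_measurable_hom_prod F2)).
rewrite -(mean_indep (D := [set rho1 a | a : 'I_k1])).
- apply: eq_Rintegral => x _; rewrite edge_prodE; last exact: enum_rank_nat_inj.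
  by rewrite arc_prod_disjoint_union sqrtrM ?arc_prod_ge0 // !hom_prod_relabel.
- exact: (bdd_measurable_relabel rho1 (bdd_measurable_hom_prod F1)).
- exact: (bdd_measurable_relabel rho2 (bdd_measurable_hom_prod F2)).
- move=> x y e; congr hom_prod; apply: eq_from_tnth => j; rewrite !tnth_mktuple.
  by apply: e; apply: imset_f.
move=> x y e; congr hom_prod; apply: eq_from_tnth => j; rewrite !tnth_mktuple.
by apply: e; rewrite inE; apply/imsetP => -[a _ /enum_rank_inj].
Qed.

Lemma mean_marginal n (v : 'I_n) (f : measurableTypeR R -> R) : bdd_measurable f ->
  \int[cube_law R n]_x f (tnth x v) = \int[unit_law R]_u f u.
Proof.
move=> bf; apply: (mean_image (h := fun x : n.-tuple R => tnth x v : measurableTypeR R)) => //.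
  exact: measurable_tnth.
move=> B mB; have [_ H] := cube_iid R n.
have := H (fun j => if j == v then B else [set: R]%classic).
rewrite (bigD1 v) //= eqxx big1 ?mule1; last by move=> j /negbTE ->; rewrite unit_lawT.
move=> <-; last by move=> j; case: eqP.
congr (cube_law R n _); apply/classical_sets.seteqP; split => x /=.
  by move=> Bx j _ /=; case: eqP => // ->.
by move=> /(_ v Logic.I); rewrite /= eqxx.
Qed.

Lemma bdd_measurable_tnth n (v : 'I_n) (f : measurableTypeR R -> R) : bdd_measurable f ->
  bdd_measurable (fun x : n.-tuple R => f (tnth x v)).
Proof.
move=> bf; apply: (bdd_measurable_comp
  (h := fun x : n.-tuple R => tnth x v : measurableTypeR R) _ bf).
exact: measurable_tnth.
Qed.

(** Given the position of the merged vertex, the two graphs read disjoint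
    groups of coordinates, so their conditional densities multiply. *)
Lemma hom_density_merge k1 k2 (F1 : sgraph 'I_k1) (F2 : sgraph 'I_k2) i1 i2 :
  hom_density (Defs.merge F1 F2 i1 i2) g =
  \int[unit_law R]_u (cond_mean i1 (hom_prod F1) u * cond_mean i2 (hom_prod F2) u).
Proof.
rewrite hom_densityE.
pose rho1 (a : 'I_k1) := enum_rank (inl a : 'I_k1 + {v : 'I_k2 | v != i2})%type.
pose rho2 (a : 'I_k2) := enum_rank (merge_inr i1 i2 a).
have inj1 : injective rho1 by move=> a b /enum_rank_inj[].
have inj2 : injective rho2 by move=> a b /enum_rank_inj/merge_inr_inj.
have b1 := bdd_measurable_cond_mean i1 (bdd_measurable_hom_prod F1).
have b2 := bdd_measurable_cond_mean i2 (bdd_measurable_hom_prod F2).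
have rho12 : rho2 i2 = rho1 i1 by rewrite /rho2 merge_inr_root.
transitivity (\int[cube_law R #|{: 'I_k1 + {v : 'I_k2 | v != i2}}|]_x
   (hom_prod F1 (relabel rho1 x) * hom_prod F2 (relabel rho2 x))).
  apply: eq_Rintegral => x _; rewrite edge_prodE; last exact: enum_rank_nat_inj.
  by rewrite arc_prod_merge sqrtrM ?arc_prod_ge0 // !hom_prod_relabel.
rewrite (mean_attach (a := i1) (D := [set rho2 a | a : 'I_k2]) inj1); first last.
- move=> x y e; congr hom_prod; apply: eq_from_tnth => j; rewrite !tnth_mktuple.
  by apply: e; apply: imset_f.
- exact: (bdd_measurable_relabel rho2 (bdd_measurable_hom_prod F2)).
- exact: bdd_measurable_hom_prod.
- move=> j /imsetP[a _ /enum_rank_inj]; rewrite /merge_inr; by case: insubP => [b _ _|_] [].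
transitivity (\int[cube_law R #|{: 'I_k1 + {v : 'I_k2 | v != i2}}|]_x
   (hom_prod F2 (relabel rho2 x) * cond_mean i1 (hom_prod F1) (tnth x (rho1 i1)))).
  by apply: eq_Rintegral => x _; rewrite mulrC.
rewrite (mean_attach (a := i2) (D := [set rho1 i1]) inj2); first last.
- by move=> x y e; congr cond_mean; apply: e; rewrite set11.
- exact: bdd_measurable_tnth b1.
- exact: bdd_measurable_hom_prod.
- by move=> j; rewrite inE -rho12 => /eqP/inj2.
rewrite rho12 -(mean_marginal (rho1 i1) (bdd_measurableM b1 b2)).
by apply: eq_Rintegral => x _; rewrite mulrC.
Qed.

Lemma mean_cond_mean k (F : sgraph 'I_k) a :
  \int[unit_law R]_u cond_mean a (hom_prod F) u = cube_density F.
Proof.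
rewrite -(mean_marginal a (bdd_measurable_cond_mean a (bdd_measurable_hom_prod F))).
have := @mean_attach R k k id a set0 (hom_prod F) (fun=> 1).
have relid x : relabel (R := R) (fun i : 'I_k => i) x = x.
  by apply: eq_from_tnth => j; rewrite tnth_mktuple.
move=> H; transitivity (\int[cube_law R k]_x (cond_mean a (hom_prod F) (tnth x a) * 1)).
  by apply: eq_Rintegral => x _; rewrite mulr1.
rewrite -H //.
- by apply: eq_Rintegral => x _; rewrite mulr1 relid.
- by move=> j; rewrite inE.
- exact: bdd_measurable_hom_prod.
- exact: bdd_measurable_cst.
Qed.

End EdgeProduct.

Section SingularGraphon.
Import mathcomp.boot.fintype mathcomp.boot.finset.
Variable (R : realType) (gamma : graphon R) (g : R * R -> R).
Hypothesis g_gamma : graphon_class gamma g.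

Lemma graphon_class_graph_function : graph_function g.
Proof. by have [g0 _ E] := graphonP gamma; move: g_gamma; rewrite E => -[]. Qed.

Let gg := graphon_class_graph_function.

Hypothesis g_singular : singular gamma.

(** Let h be the sum of the conditional means minus k t(F). The singularity
    identity for two copies of F says exactly that the integral of h^2 is zero;
    hence h is orthogonal to every Z. *)
Lemma singular_attach k (F : sgraph 'I_k) n (v : 'I_n) (Z : n.-tuple R -> R) :
  (0 < k)%N -> bdd_measurable Z ->
  \sum_(a < k) \int[cube_law R n]_x (cond_mean a (hom_prod g F) (tnth x v) * Z x) =
  k%:R * cube_density g F * \int[cube_law R n]_x Z x.
Proof.
move=> k0 bZ; have kR : k%:R != 0 :> R by rewrite pnatr_eq0 -lt0n.
pose eta a u := cond_mean a (hom_prod g F) u.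
have beta a : bdd_measurable (eta a : measurableTypeR R -> R).
  exact: bdd_measurable_cond_mean (bdd_measurable_hom_prod gg F).
pose h (u : measurableTypeR R) := \sum_(a < k) eta a u - k%:R * cube_density g F.
have bsum : bdd_measurable (fun u : measurableTypeR R => \sum_(a < k) eta a u) by apply:
  bdd_measurable_sum.
have bh : bdd_measurable h by apply: bdd_measurableB => //; apply: bdd_measurable_cst.
have sing : \sum_(a < k) \sum_(b < k) \int[unit_law R]_u (eta a u * eta b u) =
  (k%:R * cube_density g F) ^+ 2.
  have := g_singular g_gamma F F k0 k0.
  rewrite (hom_density_union gg) => E.
  have {}E : (k%:R * k%:R) * (cube_density g F * cube_density g F) =
      \sum_(a < k) \sum_(b < k) hom_density (Defs.merge F F a b) g.
    by rewrite E mulrA mulfV ?mul1r // mulf_neq0.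
  rewrite expr2 mulrACA E; apply: eq_bigr => a _; apply: eq_bigr => b _.
  by rewrite (hom_density_merge gg).
have mean_sum_eta : \int[unit_law R]_u (\sum_(a < k) eta a u) = k%:R * cube_density g F.
  rewrite mean_sum // (eq_bigr (fun=> cube_density g F)); last by move=> a _; apply:
    mean_cond_mean.
  by rewrite sumr_const card_ord mulr_natl.
have hh : \int[unit_law R]_u (h u * h u) = 0.
  transitivity (\int[unit_law R]_u (\sum_(a < k) \sum_(b < k) eta a u * eta b u +
      ((k%:R * cube_density g F) ^+ 2 - (2 * (k%:R * cube_density g F)) *
        \sum_(a < k) eta a u))).
    apply: eq_Rintegral => u _; rewrite /h -big_distrlr /=; ring.
  have bss : bdd_measurable (fun u : measurableTypeR R => \sum_(a < k) \sum_(b < k) eta a u *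
    eta b u).
    by apply: bdd_measurable_sum => a _; apply: bdd_measurable_sum => b _; apply:
      bdd_measurableM.
  rewrite meanD //; last by apply: bdd_measurableB;
    [apply: bdd_measurable_cst|apply: bdd_measurableZ].
  rewrite meanB; [|exact: bdd_measurable_cst|exact: bdd_measurableZ].
  rewrite mean_cst meanZ // mean_sum_eta mean_sum; last first.
    by move=> a _; apply: bdd_measurable_sum => b _; apply: bdd_measurableM.
  rewrite (eq_bigr (fun a => \sum_(b < k) \int[unit_law R]_u (eta a u * eta b u))).
    by rewrite sing; ring.
  by move=> a _; rewrite mean_sum // => b _; apply: bdd_measurableM.
have : \int[cube_law R n]_x (h (tnth x v) * Z x) = 0.
  apply: (mean_sqr0_orthogonal (bdd_measurable_tnth v bh) bZ).
  by rewrite (mean_marginal v (bdd_measurableM bh bh)).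
move=> H0; apply/eqP; rewrite -subr_eq0; apply/eqP; rewrite -[RHS]H0.
have bv a := bdd_measurable_tnth v (beta a).
have bZv a : bdd_measurable (fun x : n.-tuple R => eta a (tnth x v) * Z x) by apply:
  bdd_measurableM.
transitivity (\int[cube_law R n]_x (\sum_(a < k) eta a (tnth x v) * Z x) -
    k%:R * cube_density g F * \int[cube_law R n]_x Z x).
  by rewrite mean_sum // => a _; apply: bZv.
rewrite -meanZ // -meanB; [|exact: bdd_measurable_sum|exact: bdd_measurableZ].
by apply: eq_Rintegral => x _; rewrite /h mulrBl mulr_suml.
Qed.

End SingularGraphon.

(** * Uniform random maps *)

Section MapAverages.
Import mathcomp.boot.fintype mathcomp.boot.finset mathcomp.boot.finfun.
Variables (V T : finType) (R : realFieldType).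
Hypothesis T_gt0 : (0 < #|T|)%N.
Implicit Types (h : {ffun V -> T} -> R).

Definition map_mean h : R := (#|T|%:R ^+ #|V|)^-1 * \sum_phi h phi.

Let N_neq0 : #|T|%:R ^+ #|V| != 0 :> R.
Proof. by rewrite expf_neq0 // pnatr_eq0 -lt0n. Qed.

Lemma map_meanM D h1 h2 : depends_on D h1 -> depends_on (~: D) h2 ->
  map_mean (fun phi => h1 phi * h2 phi) = map_mean h1 * map_mean h2.
Proof.
move=> d1 d2; apply: (mulfI N_neq0); apply: (mulfI N_neq0).
have := @sum_mapsM V T [set: T] R D h1 h2 d1 d2; rewrite cardsT.
have onT h : \sum_(phi in ffun_on [set: T]) h phi = \sum_phi h phi.
  by apply: eq_bigl => phi; apply/ffun_onP => v; rewrite inE.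
rewrite !onT /map_mean => E.
rewrite [X in _ * X = _]mulrA mulfV // mul1r E mulrACA -!mulrA.
by rewrite ![_ * (_^-1 * _)]mulrCA !mulKf // mulrCA mulVKf.
Qed.

Lemma map_mean_prod (J : finType) (P : {set J}) (D : J -> {set V})
  (h : J -> {ffun V -> T} -> R) :
  (forall i j, i \in P -> j \in P -> i != j -> [disjoint D i & D j]) ->
  (forall j, j \in P -> depends_on (D j) (h j)) ->
  map_mean (fun phi => \prod_(j in P) h j phi) = \prod_(j in P) map_mean (h j).
Proof.
have [m] := ubnP #|P|; elim: m P => // m IH P; rewrite ltnS => Pm dD hD.
have [->|/set0Pn[j jP]] := eqVneq P set0.
  rewrite big_set0 /map_mean; under eq_bigr do rewrite big_set0.
  by rewrite sumr_const card_ffun -natrX mulVf // natrX.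
rewrite [RHS](big_setD1 j) //= -IH; first last.
- by move=> i; rewrite inE => /andP[_]; apply: hD.
- by move=> i i'; rewrite !inE => /andP[_ iP] /andP[_ iP']; apply: dD.
- by move: Pm; rewrite (cardsD1 j) jP.
rewrite -(map_meanM (D := D j)); last 2 first.
- exact: hD.
- apply: depends_on_prod => i; rewrite !inE => /andP[ij iP].
  apply: depends_on_sub (hD _ iP); rewrite -disjoints_subset; exact: dD.
by congr (_ * _); apply: eq_bigr => phi _; rewrite (big_setD1 j).
Qed.

(** The restriction of a uniform map to a set of coordinates is uniform; the
    proof exchanges these coordinates with a fresh uniform map. *)
Lemma map_mean_sub (U : finType) (iota : U -> V) (f : {ffun U -> T} -> R) :
  injective iota ->
  #|T|%:R ^+ #|U| * map_mean (fun phi => f [ffun u => phi (iota u)]) = \sum_psi f psi.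
Proof.
move=> inj; apply: (mulfI N_neq0); rewrite /map_mean mulrCA mulVKf //.
have cU : #|T|%:R ^+ #|U| = \sum_(psi : {ffun U -> T}) 1 :> R by rewrite sumr_const card_ffun
  natrX.
have cV : #|T|%:R ^+ #|V| = \sum_(phi : {ffun V -> T}) 1 :> R by rewrite sumr_const card_ffun
  natrX.
rewrite {1}cU cV !big_distrlr /= exchange_big /= !pair_bigA /=.
pose sw (p : {ffun V -> T} * {ffun U -> T}) : {ffun V -> T} * {ffun U -> T} :=
  ([ffun v => if [pick u | iota u == v] is Some u then p.2 u else p.1 v],
   [ffun u => p.1 (iota u)]).
have pickK u : [pick u' | iota u' == iota u] = Some u.
  by case: pickP => [u' /eqP/inj ->//|/(_ u)]; rewrite eqxx.
have swK : involutive sw.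
  move=> [p q]; congr (_, _); apply/ffunP => x; rewrite !ffunE /=.
    case E: [pick u | iota u == x] => [u|//].
    by rewrite ffunE; move: E; case: pickP => // u' /eqP <- [->].
  by rewrite ?ffunE pickK.
rewrite [RHS](reindex_inj (inv_inj swK)) /=; apply: eq_bigr => p _.
by rewrite !mul1r.
Qed.

End MapAverages.

(** * The sampled graph *)

Section SampledGraph.
Import mathcomp.boot.fintype mathcomp.boot.finset mathcomp.boot.finfun.
Variables (R : realType).

Lemma prodr_bool (I : finType) (P b : pred I) :
  \prod_(i | P i) (b i)%:R = [forall (i | P i), b i]%:R :> R.
Proof.
have [/forall_inP H|/forall_inPn[i Pi bi]] := boolP [forall (i | P i), b i].
  by rewrite big1 // => i Pi; rewrite H.
by rewrite (bigD1 i) //= (negbTE bi) mul0r.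
Qed.

Lemma unit_law_le (c : R) : 0 <= c -> c <= 1 -> unit_law R `]-oo, c]%classic = c%:E.
Proof.
move=> c0 c1.
rewrite -[LHS]/(\int[lebesgue_measure]_(x in `]-oo, c]%classic) (uniform_pdf 0 1 x)%:E)%E.
rewrite integral_uniform_pdf.
rewrite (_ : (`]-oo, c] `&` `[0, 1])%classic = `[0, c]%classic); last first.
  apply/classical_sets.seteqP; split => x /=; rewrite !in_itv /=.
    by move=> [-> /andP[->]].
  by move=> /andP[x0 xc]; rewrite x0 xc (le_trans xc c1).
rewrite (eq_integral (cst 1%:E)); last first.
  move=> x; move/set_mem; rewrite /= in_itv /= => /andP[x0 xc].
  by rewrite /uniform_pdf x0 (le_trans xc c1) subr0 invr1.
rewrite integral_cst //= lebesgue_measure_itv /= lte_fin mul1e.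
case: ltP => [_|c_le0]; first by rewrite sube0.
by congr EFin; apply/eqP; rewrite eq_le c0 c_le0.
Qed.

Lemma mean_unit_le (c : R) : 0 <= c <= 1 -> \int[unit_law R]_u (u <= c)%R%:R = c.
Proof.
move=> /andP[c0 c1].
have mA : measurable (`]-oo, c]%classic : set (measurableTypeR R)) by exact: measurable_itv.
transitivity (\int[unit_law R]_u \1_(`]-oo, c]%classic) u).
  apply: eq_Rintegral => u _; rewrite indicE; congr (_%:R); congr nat_of_bool.
  by apply/idP/idP => [uc|/set_mem]; [apply: mem_set|]; rewrite /= in_itv /=.
rewrite /Rintegral integral_indic // classical_sets.setIT.
by rewrite -[RHS]/(fine c%:E) -(unit_law_le c0 c1).
Qed.

Section BooleanMeasurable.
Context d (T : measurableType d).

Lemma bdd_measurable_ler (f1 f2 : T -> R) :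
  measurable_fun [set: T]%classic f1 -> measurable_fun [set: T]%classic f2 ->
  bdd_measurable (fun w => (f1 w <= f2 w)%R%:R : R).
Proof.
move=> m1 m2; split; last by exists 1 => w; case: (f1 w <= f2 w);
  rewrite ?normr1 ?normr0 ?ler01.
rewrite (_ : (fun _ => _) = (fun w => if f1 w <= f2 w then 1 else 0)); last first.
  by apply/funext => w; case: (f1 w <= f2 w).
apply: measurable_fun_if => //=; exact: measurable_fun_ler.
Qed.

End BooleanMeasurable.

Variables (n : nat) (d : measure_display) (Omega : measurableType d).
Variables (P : probability Omega R) (g : R * R -> R).
Variables (X : 'I_n -> {RV P >-> R}) (U : increasing_pair n -> {RV P >-> R}).
Hypothesis XU : W_sample X U.
Hypothesis gg : graph_function g.

Definition drivers (a : 'I_n + increasing_pair n) : Omega -> R :=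
  match a with inl i => X i : Omega -> R | inr p => U p end.

Lemma iid_drivers : iid_uniform P drivers.
Proof.
split=> [[i|p]|A mA]; [exact: measurable_funPT|exact: measurable_funPT|].
have := XU_independent XU [set: 'I_n + increasing_pair n] mA.
rewrite -/drivers => H; transitivity (\prod_(a in [set: 'I_n + increasing_pair n]) P
  (drivers a @^-1` A a)%classic)%E.
  rewrite -H; congr (P _); apply/classical_sets.seteqP; split => w Hw a.
    by move=> _; apply: Hw.
  by move=> _; apply: Hw; rewrite /= inE.
rewrite (eq_bigl predT); last by move=> a; rewrite inE.
apply: eq_bigr => -[i|p] _ /=.
  exact: (X_uniform XU i (mA (inl i))).
exact: (U_uniform XU p (mA (inr p))).
Qed.

Definition linked (p : increasing_pair n) (w : Omega) : bool :=
  U p w <= g (X (val p).1 w, X (val p).2 w).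

Lemma linkedE p w : linked p w = (U p w <= gbar g (X (val p).1 w, X (val p).2 w)).
Proof.
rewrite /linked /gbar /=.
have Xu i : in_unit (X i w) by apply/in_unitP; exact: (X_range XU).
by rewrite !Xu.
Qed.

Lemma bdd_measurable_linked p : bdd_measurable (fun w => (linked p w)%:R : R).
Proof.
apply: (@eq_bmeas _ _ _ (fun w => (U p w <= gbar g (X (val p).1 w, X (val p).2 w))%R%:R)).
  by move=> w; rewrite linkedE.
apply: bdd_measurable_ler; first exact: measurable_funPT.
apply: (measurableT_comp (measurable_gbar gg)).
by apply/measurable_fun_pairP; split; apply: measurable_funPT.
Qed.

Lemma integrate_gate N (p i j : 'I_N) x : i != p -> j != p ->
  integrate_coord p (fun x : N.-tuple R => (tnth x p <= gbar g (tnth x i, tnth x j))%R%:R) x =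
  gbar g (tnth x i, tnth x j).
Proof.
move=> /negbTE ip /negbTE jp; rewrite -[RHS](mean_unit_le (gbar01 gg _)).
apply: eq_Rintegral => u _.
by rewrite !tnth_mktuple eqxx ip jp.
Qed.

Lemma bdd_measurable_gate N (p i j : 'I_N) :
  bdd_measurable (fun x : N.-tuple R => (tnth x p <= gbar g (tnth x i, tnth x j))%R%:R : R).
Proof.
apply: bdd_measurable_ler; first exact: measurable_tnth.
by have [] := bdd_measurable_gbar gg i j.
Qed.

(** Integrating out the threshold p a turns its indicator into the edge
    probability; thresholds and positions use different coordinates, so this
    can be done one threshold at a time. *)
Lemma integrate_gates (J : eqType) N (s : seq J) (p i j : J -> 'I_N) x :
  uniq (map p s) -> (forall a b, i a != p b /\ j a != p b) ->
  integrate_coords (map p s) (fun x : N.-tuple R =>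
     \prod_(a <- s) (tnth x (p a) <= gbar g (tnth x (i a), tnth x (j a)))%R%:R) x =
  \prod_(a <- s) gbar g (tnth x (i a), tnth x (j a)).
Proof.
move=> + ij; elim: s x => [|a s IH] x; first by rewrite /= !big_nil.
rewrite map_cons cons_uniq => /andP[as_ us].
pose term := fun y : N.-tuple R => (tnth y (p a) <= gbar g (tnth y (i a), tnth y (j a)))%R%:R
  : R.
pose G := fun y : N.-tuple R => \prod_(b <- s) gbar g (tnth y (i b), tnth y (j b)).
have E : integrate_coords (map p s) (fun x : N.-tuple R =>
     \prod_(b <- a :: s) (tnth x (p b) <= gbar g (tnth x (i b), tnth x (j b)))%R%:R) =
     fun y => G y * term y.
  apply/funext => y; rewrite /G -IH // mulrC -integrate_coordsM.
  - by congr integrate_coords; apply/funext => z; rewrite big_cons.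
  - have out (q : 'I_N) : (forall b, q != p b) -> q \in ~: [set b in map p s].
      by move=> qp; rewrite !inE; apply/mapP => -[b _ e]; case/eqP: (qp b).
    move=> z z' e; rewrite /term !e //.
    + by apply: out => b; have [] := ij a b.
    + by apply: out => b; have [] := ij a b.
    by rewrite !inE.
  by apply: bdd_measurable_prod => b _; apply: bdd_measurable_gate.
rewrite -[LHS]/(integrate_coord (p a) (integrate_coords (map p s) _) x) E integrate_coordM.
- by rewrite integrate_gate ?(ij a a).1 ?(ij a a).2 // big_cons mulrC.
- by move=> z z' e; apply: eq_bigr => b _; rewrite !e // !inE; have [] := ij b a.
exact: bdd_measurable_gate.
Qed.

(** The thresholds U are integrated out first, leaving a function of the
    positions X. *)
Lemma mean_linked (E : {set 'I_n * 'I_n}) :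
  \int[P]_w (\prod_(p : increasing_pair n | val p \in E) (linked p w)%:R) =
  \int[cube_law R n]_x
    (\prod_(p : increasing_pair n | val p \in E) gbar g (tnth x (val p).1, tnth x (val p).2)).
Proof.
pose N := #|{: 'I_n + increasing_pair n}|.
pose Y (i : 'I_N) := drivers (enum_val i).
have iidY : iid_uniform P Y by apply: iid_uniform_inj iid_drivers; apply: enum_val_inj.
pose xi (i : 'I_n) : 'I_N := enum_rank (inl i).
pose ui (p : increasing_pair n) : 'I_N := enum_rank (inr p).
pose s := [seq p <- enum {: increasing_pair n} | val p \in E].
pose f (x : N.-tuple R) : R := \prod_(p <- s)
   (tnth x (ui p) <= gbar g (tnth x (xi (val p).1), tnth x (xi (val p).2)))%R%:R.
have bf : bdd_measurable f by apply: bdd_measurable_prod => p _; apply: bdd_measurable_gate.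
transitivity (\int[P]_w f [tuple Y i w | i < N]).
  apply: eq_Rintegral => w _; rewrite /f /s big_filter big_enum_cond /=.
  apply: eq_bigr => p _; rewrite linkedE !tnth_mktuple /Y /xi /ui !enum_rankK.
  by [].
rewrite (mean_iid iidY bf) -(mean_integrate_coords (map ui s) bf).
transitivity (\int[cube_law R N]_x \prod_(p <- s) gbar g
  (tnth x (xi (val p).1), tnth x (xi (val p).2))).
  apply: eq_Rintegral => x _; apply: integrate_gates.
    rewrite map_inj_uniq; last by move=> p q /enum_rank_inj[].
    by apply: filter_uniq; apply: enum_uniq.
  by move=> p q; split; apply/eqP => /enum_rank_inj.
have inj_xi : injective xi by move=> i j /enum_rank_inj[].
rewrite -(mean_relabel inj_xi); last by apply: bdd_measurable_prod => p _; apply: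
  bdd_measurable_gbar.
apply: eq_Rintegral => x _; rewrite /s big_filter big_enum_cond /=.
by apply: eq_bigr => p _; rewrite !tnth_mktuple.
Qed.

Definition pair_prod (E : {set 'I_n * 'I_n}) (x : n.-tuple R) : R :=
  \prod_(q in E) gbar g (tnth x q.1, tnth x q.2).

Lemma bdd_measurable_pair_prod E : bdd_measurable (pair_prod E).
Proof. by apply: bdd_measurable_prod => q _; apply: bdd_measurable_gbar. Qed.

Lemma pair_prodE (E : {set 'I_n * 'I_n}) x : (forall q, q \in E -> (q.1 < q.2)%N) ->
  \prod_(p : increasing_pair n | val p \in E) gbar g (tnth x (val p).1, tnth x (val p).2) =
  pair_prod E x.
Proof.
move=> Einc; rewrite /pair_prod.
rewrite -(big_sub_cond (fun q : 'I_n * 'I_n => (q.1 < q.2)%N) (fun q => q \in E)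
  (fun q => gbar g (tnth x q.1, tnth x q.2))).
apply: eq_bigl => q; rewrite [_ \in _]/=; case qE: (q \in E); last by rewrite andbF.
by rewrite andbT; apply: Einc.
Qed.

End SampledGraph.

(** * Moments of the homomorphism events *)

Section Moments.
Import mathcomp.boot.fintype mathcomp.boot.finset mathcomp.boot.finfun.
Variables (R : realType) (s : nat) (k : 'I_s -> nat) (F : forall i : 'I_s, sgraph 'I_(k i)).
Variables (n : nat) (d : measure_display) (Omega : measurableType d).
Variables (P : probability Omega R) (g : R * R -> R).
Variables (X : 'I_n -> {RV P >-> R}) (U : increasing_pair n -> {RV P >-> R}).
Hypothesis XU : W_sample X U.
Hypothesis gg : graph_function g.
Local Notation G w := (W_graph g (X ^~ w) (U ^~ w)).
Implicit Types (phi psi : {ffun vertices k -> 'I_n}) (A B S : {set 'I_s}).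

(** The definition of the graph allows either orientation of a pair, but
    increasing pairs have only one. *)
Lemma W_graph_linked (p : increasing_pair n) w :
  G w (val p).1 (val p).2 = linked g X U p w.
Proof.
apply/existsP/idP => [[q /andP[qp]]|lp]; last first.
  by exists p; rewrite -surjective_pairing eqxx.
have [/eqP e|ne] /= := boolP (val q == ((val p).1, (val p).2)).
  by have -> : q = p by apply: val_inj; rewrite e -surjective_pairing.
move: qp; rewrite (negbTE ne) /= => /eqP e.
by have := valP q; have := valP p; rewrite /= e /=; move=> /ltnW; rewrite leqNgt => /negP.
Qed.

Definition hom_event phi j (w : Omega) : bool :=
  [forall u, forall v, F j u v ==> G w (phi (vtx u)) (phi (vtx v))].

Definition covers phi j (q : 'I_n * 'I_n) : bool :=
  [exists u, exists v, [&& F j u v, phi (vtx u) == q.1 & phi (vtx v) == q.2]].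

Definition edges phi B : {set 'I_n * 'I_n} :=
  [set q : 'I_n * 'I_n | (q.1 < q.2)%N && [exists j in B, covers phi j q]].

Definition loopy phi B : bool := [exists j in B, exists x, covers phi j (x, x)].

(** Edges landing on the same pair ask for the same link, and an edge collapsed
    to a point asks for a loop, which the graph never has. *)
Lemma hom_eventE phi B w :
  [forall (j | j \in B), hom_event phi j w] =
  ~~ loopy phi B && [forall (p : increasing_pair n | val p \in edges phi B), linked g X U p w].
Proof.
apply/forall_inP/andP => [H|[nl /forall_inP H] j jB].
  have Hj j q : j \in B -> covers phi j q -> G w q.1 q.2.
    move=> jB /existsP[u /existsP[v /and3P[Fuv /eqP <- /eqP <-]]].
    by have /forallP/(_ u)/forallP/(_ v)/implyP := H j jB; apply.
  split; first by apply/existsP => -[j /andP[jB /existsP[x /(Hj _ _ jB)]]]; rewrite adj_irr.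
  apply/forall_inP => p; rewrite inE => /andP[_ /existsP[j /andP[jB /(Hj _ _ jB)]]].
  by rewrite W_graph_linked.
apply/forallP => u; apply/forallP => v; apply/implyP => Fuv.
have use_uv : covers phi j (phi (vtx u), phi (vtx v)).
  by apply/existsP; exists u; apply/existsP; exists v; rewrite Fuv !eqxx.
have use_vu : covers phi j (phi (vtx v), phi (vtx u)).
  by apply/existsP; exists v; apply/existsP; exists u; rewrite adj_sym Fuv !eqxx.
have lk (a b : 'I_n) : (a < b)%N -> covers phi j (a, b) -> G w a b.
  move=> ab ujab; rewrite -[G w a b]/(G w (val (Sub (a, b) ab : increasing_pair n)).1
    (val (Sub (a, b) ab : increasing_pair n)).2).
  rewrite W_graph_linked; apply: H; rewrite inE /= ab /=.
  by apply/existsP; exists j; rewrite jB.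
case: (ltngtP (phi (vtx u)) (phi (vtx v))) => [uv|vu|/val_inj e].
- exact: lk.
- by rewrite adj_sym; apply: lk.
case/negP: nl; apply/existsP; exists j; rewrite jB /=; apply/existsP; exists (phi (vtx v)).
by move: use_uv; rewrite e.
Qed.

Definition moment phi B : R := \int[P]_w \prod_(j in B) (hom_event phi j w)%:R.

Lemma hom_event_prodE phi B w :
  \prod_(j in B) (hom_event phi j w)%:R =
  (~~ loopy phi B)%:R * \prod_(p : increasing_pair n | val p \in edges phi B)
    (linked g X U p w)%:R :> R.
Proof. by rewrite !prodr_bool hom_eventE -natrM mulnb. Qed.

Lemma bdd_measurable_hom_event_prod phi B :
  bdd_measurable (fun w => \prod_(j in B) (hom_event phi j w)%:R : R).
Proof.
apply: (@eq_bmeas _ _ _ (fun w => (~~ loopy phi B)%:R *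
  \prod_(p : increasing_pair n | val p \in edges phi B) (linked g X U p w)%:R)).
  by move=> w; rewrite hom_event_prodE.
by apply: bdd_measurableZ; apply: bdd_measurable_prod => p _; apply: bdd_measurable_linked.
Qed.

Lemma momentE phi B : moment phi B =
  (~~ loopy phi B)%:R * \int[cube_law R n]_x pair_prod g (edges phi B) x.
Proof.
rewrite /moment.
transitivity (\int[P]_w ((~~ loopy phi B)%:R *
  \prod_(p : increasing_pair n | val p \in edges phi B) (linked g X U p w)%:R)).
  by apply: eq_Rintegral => w _; rewrite hom_event_prodE.
rewrite meanZ; last by apply: bdd_measurable_prod => p _; apply: bdd_measurable_linked.
rewrite mean_linked //; congr (_ * _); apply: eq_Rintegral => x _.
by apply: pair_prodE => q; rewrite inE => /andP[].
Qed.

Lemma moment0 phi : moment phi set0 = 1.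
Proof.
rewrite /moment -[RHS](mean_cst P); apply: eq_Rintegral => w _.
by rewrite big_set0.
Qed.

Lemma moment_le1 phi B : `|moment phi B| <= 1.
Proof.
apply: mean_norm_le; first exact: bdd_measurable_hom_event_prod.
by move=> w; rewrite prodr_bool; case: [forall _ in _, _]; rewrite ?normr1 ?normr0 ?ler01.
Qed.

Lemma moment_dep B : depends_on (block k B) (fun phi => moment phi B).
Proof.
move=> phi psi e; apply: eq_Rintegral => w _; apply: eq_bigr => j jB.
congr (_%:R); congr nat_of_bool; apply: eq_forallb => u; apply: eq_forallb => v.
by rewrite !e // inE.
Qed.

Lemma eq_covers phi psi B j q : {in block k B, phi =1 psi} -> j \in B ->
  covers phi j q = covers psi j q.
Proof.
move=> e jB; apply: eq_existsb => u; apply: eq_existsb => v.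
by rewrite !e // inE.
Qed.

Lemma eq_edges phi psi B : {in block k B, phi =1 psi} -> edges phi B = edges psi B.
Proof.
move=> e; apply/setP => q; rewrite !inE; congr (_ && _).
by apply: eq_existsb => j; case jB: (j \in B) => //=; apply: eq_covers jB.
Qed.

Lemma eq_loopy phi psi B : {in block k B, phi =1 psi} -> loopy phi B = loopy psi B.
Proof.
move=> e; apply: eq_existsb => j; case jB: (j \in B) => //=.
by apply: eq_existsb => x; apply: eq_covers jB.
Qed.

Lemma edgesU phi A B : edges phi (A :|: B) = edges phi A :|: edges phi B.
Proof.
apply/setP => q; rewrite !inE -andb_orr; congr (_ && _).
apply/existsP/orP => [[j]|].
  by rewrite inE => /andP[/orP[] jB uj]; [left|right]; apply/existsP; exists j; rewrite jB.
by case=> /existsP[j /andP[jB uj]]; exists j; rewrite inE jB uj ?orbT.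
Qed.

Lemma loopyU phi A B : loopy phi (A :|: B) = loopy phi A || loopy phi B.
Proof.
apply/existsP/orP => [[j]|].
  by rewrite inE => /andP[/orP[] jB uj]; [left|right]; apply/existsP; exists j; rewrite jB.
by case=> /existsP[j /andP[jB uj]]; exists j; rewrite inE jB uj ?orbT.
Qed.

Lemma edges_values phi B q : q \in edges phi B ->
  [/\ q.1 \in values phi B, q.2 \in values phi B & q.1 != q.2].
Proof.
rewrite inE => /andP[lt_q /existsP[j /andP[jB
  /existsP[u /existsP[v /and3P[_ /eqP e1 /eqP e2]]]]]].
split; first by rewrite -e1; apply: imset_f; rewrite inE.
  by rewrite -e2; apply: imset_f; rewrite inE.
by apply: contraTneq lt_q => ->; rewrite ltnn.
Qed.

Lemma pair_prodU (E1 E2 : {set 'I_n * 'I_n}) (x : n.-tuple R) : [disjoint E1 & E2] ->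
  pair_prod g (E1 :|: E2) x = pair_prod g E1 x * pair_prod g E2 x.
Proof.
move=> dE; rewrite /pair_prod (big_setID E1) /=; congr (_ * _); apply: eq_bigl => q.
  by rewrite !inE andbC; case: (q \in E1).
rewrite !inE; case qE: (q \in E1) => //=.
by rewrite (disjointFr dE qE).
Qed.

Lemma tuple_depends_on_pair_prod phi B :
  tuple_depends_on (values phi B) (pair_prod g (edges phi B)).
Proof.
move=> x y e; apply: eq_bigr => q /edges_values[q1 q2 _].
by rewrite !e.
Qed.

(** Disjoint images involve disjoint sets of pairs and of positions. *)
Lemma moment_indep phi A B :
  (forall t, t \in values phi A -> t \in values phi B -> false) ->
  moment phi (A :|: B) = moment phi A * moment phi B.
Proof.
move=> dAB; rewrite !momentE loopyU edgesU negb_or -mulnb natrM mulrACA; congr (_ * _).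
rewrite -(mean_indep (D := values phi A)).
- apply: eq_Rintegral => x _; apply: pair_prodU.
  apply/pred0P => q /=; apply/negP => /andP[/edges_values[qA _ _] /edges_values[qB _ _]].
  by have := dAB _ qA qB.
- exact: bdd_measurable_pair_prod.
- exact: bdd_measurable_pair_prod.
- exact: tuple_depends_on_pair_prod.
apply: (tuple_depends_on_sub _ (@tuple_depends_on_pair_prod phi B)); apply/subsetP => t tB;
  rewrite inE.
by apply/negP => tA; have := dAB _ tA tB.
Qed.

Section InjectiveBlock.
Variables (psi : {ffun vertices k -> 'I_n}) (i : 'I_s).
Definition placement : 'I_(k i) -> 'I_n := fun u => psi (vtx u).
Hypothesis psi_inj : injective placement.

Lemma loopy_injective : loopy psi [set i] = false.
Proof.
apply/existsP => -[j /andP[]]; rewrite inE => /eqP -> {j}.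
move=> /existsP[x /existsP[u /existsP[v /and3P[Fuv /eqP eu /eqP ev]]]].
have uv : u = v by apply: psi_inj; rewrite /placement eu ev.
by rewrite uv adj_irr in Fuv.
Qed.

(** An injective placement sends distinct edges to distinct pairs; orienting
    each edge along the placement makes its pair increasing. *)
Lemma pair_prod_injective x :
  pair_prod g (edges psi [set i]) x = hom_prod g (F i) (relabel placement x).
Proof.
rewrite (hom_prod_relabel gg) -(@edge_prodE R g gg _ (F i) (fun u => placement u)); last first.
  by move=> u v /val_inj/psi_inj.
pose E := [set e : 'I_(k i) * 'I_(k i) | F i e.1 e.2 && (placement e.1 < placement e.2)%N].
have -> : edges psi [set i] = [set (placement e.1, placement e.2) | e in E].
  apply/setP => q; apply/idP/imsetP => [|[e]]; rewrite !inE.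
    move=> /andP[lt_q /existsP[j /andP[]]]; rewrite inE => /eqP ji; subst j.
    move=> /existsP[u /existsP[v /and3P[Fuv /eqP eu /eqP ev]]].
    exists (u, v); first by rewrite inE /= Fuv /placement eu ev.
    by rewrite /placement /= eu ev -surjective_pairing.
  move=> /andP[Fe lt_e] -> /=; rewrite lt_e /=; apply/existsP; exists i; rewrite set11 /=.
  by apply/existsP; exists e.1; apply/existsP; exists e.2; rewrite Fe !eqxx.
rewrite /pair_prod big_imset /=; last by move=> [u v] [u' v'] _ _ /= [/psi_inj -> /psi_inj ->].
by apply: eq_bigl => e; rewrite inE.
Qed.

End InjectiveBlock.

Hypothesis singular_step : forall k (F : sgraph 'I_k) (v : 'I_n) (Z : n.-tuple R -> R),
  (0 < k)%N -> bdd_measurable Z ->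
  \sum_(a < k) \int[cube_law R n]_x (cond_mean a (hom_prod g F) (tnth x v) * Z x) =
  k%:R * cube_density g F * \int[cube_law R n]_x Z x.

(** The swaps let each vertex a of F_i in turn sit at the common value t, the
    other vertices occupying values that no other block uses. Conditionally on
    the position of t the leaf contributes the conditional density of F_i given
    a, and [singular_attach] sums these. *)
Lemma moment_leaf phi i (a0 : 'I_(k i)) : leaf phi i ->
  phi (vtx a0) \in values phi [set~ i] -> forall S, i \notin S ->
  \sum_(a < k i) moment (swap_vtx phi (vtx a0) (vtx a)) (i |: S) =
  (k i)%:R * cube_density g (F i) * moment phi S.
Proof.
move=> lf att S iS; have /andP[/eqP card_i /cards1P[t tE]] := lf.
have phi_inj : {in block k [set i] &, injective phi}.
  by apply/imset_injP; rewrite card_block1; apply/eqP.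
have only_t y : y \in values phi [set i] -> y \in values phi S -> y = t.
  move=> yi yS; apply/eqP; rewrite -in_set1 -tE inE yi /=.
  move: yS => /imsetP[v]; rewrite inE => vS ->; apply: imset_f; rewrite !inE.
  by apply: contraNneq iS => <-.
have t_a0 : phi (vtx a0) = t.
  apply/eqP; rewrite -in_set1 -tE inE att andbT; apply: imset_f; rewrite !inE //.
pose psi (a : 'I_(k i)) := swap_vtx phi (vtx a0) (vtx a).
have psi_inj a : injective (placement (psi a) (i := i)).
  move=> u v; rewrite /placement !ffunE => e.
  have tp (w : 'I_(k i)) : tperm (vtx a0) (vtx a) (vtx w) \in block k [set i].
    by case: tpermP => *; rewrite !inE /= eqxx.
  by have /perm_inj/vtx_inj := phi_inj _ _ (tp u) (tp v) e.
have psi_S a : {in block k S, psi a =1 phi}.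
  move=> v; rewrite inE ffunE => vS.
  by case: tpermP vS => // -> /=; rewrite (negbTE iS).
have psi_a (a : 'I_(k i)) : placement (psi a) a = t by rewrite /placement ffunE tpermR.
have im_i a (u : 'I_(k i)) : placement (psi a) u \in values phi [set i].
  by rewrite /placement -(values_swap_vtx phi a0 a); apply: imset_f; rewrite !inE.
have k0 : (0 < k i)%N by apply: leq_ltn_trans (ltn_ord a0).
rewrite momentE mulrCA -(singular_step _ t) //; last exact: bdd_measurable_pair_prod.
rewrite mulr_sumr; apply: eq_bigr => a _.
rewrite momentE loopyU (loopy_injective (@psi_inj a)) /= (eq_loopy (@psi_S a)); congr (_ * _).
rewrite -(psi_a a) -(mean_attach (D := values phi S) (@psi_inj a)); first last.
- exact: tuple_depends_on_pair_prod.
- exact: bdd_measurable_pair_prod.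
- exact: bdd_measurable_hom_prod.
- by move=> u uS; apply: (@psi_inj a); rewrite psi_a; apply: only_t.
apply: eq_Rintegral => x _; rewrite edgesU pair_prodU.
  by rewrite (pair_prod_injective (@psi_inj a)) (eq_edges (@psi_S a)).
rewrite (eq_edges (@psi_S a)); apply/pred0P => q /=.
apply/negP => /andP[/edges_values[q1 q2 /eqP ne] /edges_values[q1' q2' _]]; apply: ne.
rewrite values_swap_vtx in q1; rewrite values_swap_vtx in q2.
by rewrite (only_t _ q1 q1') (only_t _ q2 q2').
Qed.

Hypothesis n_gt0 : (0 < n)%N.

(** A map of block j alone extends to the other blocks in the same number of
    ways, whatever it is. *)
Lemma S_hom_mean j w :
  S_hom g X U (F j) w = n%:R ^+ k j * map_mean (fun phi => (hom_event phi j w)%:R).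
Proof.
pose f (h : {ffun 'I_(k j) -> 'I_n}) : R :=
  [forall u, forall v, F j u v ==> G w (h u) (h v)]%:R.
transitivity (\sum_h f h).
  rewrite /S_hom /hom_count -sum1_card natr_sum big_mkcond /=.
  by apply: eq_bigr => h _; rewrite /f inE; case: ifP.
have T0 : (0 < #|'I_n|)%N by rewrite card_ord.
rewrite -(map_mean_sub T0 f (@vtx_inj _ k j)) !card_ord; congr (_ * _).
congr map_mean; apply/funext => phi; congr (_%:R); congr nat_of_bool.
by apply: eq_forallb => u; apply: eq_forallb => v; rewrite !ffunE.
Qed.

(** Each factor of each partition term is a mean over maps of a function
    reading only the blocks of one part; since these parts are disjoint, the
    product of the means is the mean of the product. *)
Lemma joint_cumulant_kappa :
  joint_cumulant P (fun j => S_hom g X U (F j)) = \sum_phi kappa moment phi.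
Proof.
have T0 : (0 < #|'I_n|)%N by rewrite card_ord.
have E_S B : fine 'E_P[fun w => \prod_(j in B) S_hom g X U (F j) w] =
    (\prod_(j in B) n%:R ^+ k j) * map_mean (fun phi => moment phi B).
  rewrite unlock.
  transitivity (\int[P]_w ((\prod_(j in B) n%:R ^+ k j) * ((#|'I_n|%:R ^+ #|vertices k|)^-1 *
      \sum_(phi : {ffun vertices k -> 'I_n}) \prod_(j in B) (hom_event phi j w)%:R))).
    apply: eq_Rintegral => w _.
    under eq_bigr do rewrite S_hom_mean.
    rewrite big_split /=; congr (_ * _).
    rewrite -(map_mean_prod T0 (D := fun j => block k [set j])) //.
      move=> i j _ _ ij; apply/pred0P => v /=; rewrite !inE.
      by apply/negP => /andP[/eqP ei /eqP ej]; rewrite -ei -ej eqxx in ij.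
    move=> j _ phi psi e; congr (_%:R); congr nat_of_bool.
    by apply: eq_forallb => u; apply: eq_forallb => v; rewrite !e // !inE.
  have bphi : bdd_measurable (fun w => \sum_(phi : {ffun vertices k -> 'I_n}) \prod_(j in B)
    (hom_event phi j w)%:R : R).
    by apply: bdd_measurable_sum => phi _; apply: bdd_measurable_hom_event_prod.
  rewrite meanZ; last exact: bdd_measurableZ.
  rewrite meanZ // mean_sum // => phi _; exact: bdd_measurable_hom_event_prod.
rewrite /kappa exchange_big /=; apply: eq_bigr => pi pi_part.
rewrite -mulr_sumr; congr (_ * _).
rewrite (eq_bigr _ (fun B _ => E_S B)) big_split /=.
rewrite -(map_mean_prod T0 (D := fun B => block k B)); first last.
- by move=> B _; apply: moment_dep.
- move=> A B Api Bpi AB; have /trivIsetP tI := partition_trivIset pi_part.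
  have dAB := tI _ _ Api Bpi AB; apply/pred0P => v /=; rewrite !inE.
  by apply/negP => /andP[vA]; rewrite (disjointFr dAB vA).
have -> : \prod_(B in pi) \prod_(j in B) n%:R ^+ k j = n%:R ^+ #|vertices k| :> R.
  rewrite -(set_partition_big pi pi_part) card_vertices /= -prodrXr.
  by apply: eq_bigl => j; rewrite inE.
by rewrite /map_mean card_ord mulVKf // expf_neq0 // pnatr_eq0 -lt0n.
Qed.

End Moments.

Theorem theorem38 (R : realType) (s : nat) (gamma : graphon R)
    (k : 'I_s -> nat) (F : forall i : 'I_s, sgraph 'I_(k i)) (n : nat)
    (d : measure_display) (Omega : measurableType d) (P : probability Omega R)
    (g : R * R -> R) (X : 'I_n -> {RV P >-> R})
    (U : increasing_pair n -> {RV P >-> R}) :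
  (2 <= s)%N ->
  singular gamma ->
  (forall i, (2 <= k i)%N) ->
  (1 <= n)%N ->
  graphon_class gamma g ->
  W_sample X U ->
  `| joint_cumulant P (fun i : 'I_s => S_hom g X U (F i)) | <=
    2 ^+ (s - 1) * (\sum_(i < s) k i)%:R ^+ s * (\prod_(i < s) k i)%:R *
    n%:R ^+ ((\sum_(i < s) k i) - s).
Proof.
move=> s2 sing k2 n1 g_gamma XU.
have gg := graphon_class_graph_function g_gamma.
have i0 : 'I_s by exact: Ordinal (ltnW s2).
have k_gt0 i : (0 < k i)%N by apply: ltn_trans (k2 i).
rewrite (joint_cumulant_kappa F XU gg n1).
have step j (Fj : sgraph 'I_j) v Z := @singular_attach R gamma g g_gamma sing j Fj n v Z.
have := @abstract_bound 'I_s 'I_n k R i0 (moment F g X U).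
rewrite !card_ord; apply => //.
- exact: moment0.
- exact: moment_le1.
- exact: moment_indep.
- exact: moment_dep.
- exact: moment_leaf.
Qed.
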